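(* Let $p=p(n)\in(0,1)$ satisfy $p\to0$ and $n^{1/2}p\to\infty$ as $n\to\infty$, and let $\delta=\delta_n$ be a sequence with $0<\delta_n<1$ and $\delta_n np/n^{1/2}\to\infty$. Then $$\lim_{n\to\infty}\frac{-\log\mathbb{P}\big(\lambda_2(\mathcal{G}_{n,p})\ge\delta np\big)}{\tfrac12\delta^2n^2p^2\log(1/p)}=1.$$
   Context: $\mathcal{G}_{n,p}$ is the Erdős–Rényi random graph on $n$ vertices in which each of the $\binom n2$ edges is present independently with probability $p$. $\lambda_1(\mathcal{G}_{n,p})\ge\lambda_2(\mathcal{G}_{n,p})\ge\cdots\ge\lambda_n(\mathcal{G}_{n,p})$ are the eigenvalues of its adjacency matrix; $\lambda_2$ is the second largest (counted with multiplicity). *)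

(* Defs.v *)
From mathcomp Require Import all_boot all_order all_algebra.
From mathcomp Require Import complex polyrcf.
From mathcomp Require Import all_classical all_reals all_analysis.

Set Implicit Arguments.
Unset Strict Implicit.
Unset Printing Implicit Defensive.

Import Order.TTheory GRing.Theory Num.Theory.
Import numFieldNormedType.Exports.

Local Open Scope ring_scope.

Section Eigenvalues.
Variables (R : rcfType) (n : nat).
Implicit Types A : 'M[R]_n.

(* The real eigenvalues of A in nonincreasing order, each repeated according to
   its algebraic multiplicity; for symmetric A these are all n eigenvalues, see
   char_poly_eigvals and size_eigvals. *)
Definition eigvals A : seq R :=
  flatten [seq nseq (mup x (char_poly A)) x | x <- rev (rootsR (char_poly A))].

(* [lambda k A] is the k-th largest eigenvalue, counted from k = 1; it is 0 by
   convention when A has fewer than k real eigenvalues. *)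
Definition lambda (k : nat) A : R := nth 0 (eigvals A) k.-1.

Lemma count_eigvals A x : count_mem x (eigvals A) = mup x (char_poly A).
Proof.
have p0 : char_poly A != 0 by apply: monic_neq0; exact: char_poly_monic.
rewrite /eigvals; set p := char_poly A in p0 *.
have inr y : (y \in rev (rootsR p)) = root p y.
  by rewrite mem_rev -roots_on_rootsR // inE.
have ur : uniq (rev (rootsR p)) by rewrite rev_uniq uniq_roots.
rewrite count_flatten -map_comp sumnE big_map.
rewrite (eq_bigr (fun y => if y == x then mup x p else 0%N)); last first.
  move=> y _ /=; rewrite count_nseq /=; case: eqP => [->|_]; last by rewrite mul0n.
  by rewrite mul1n.
rewrite -big_mkcond /=; have [rx|nrx] := boolP (root p x).
  by rewrite -big_filter filter_pred1_uniq ?inr // big_seq1.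
by rewrite (mupNroot nrx) big1_eq.
Qed.

Lemma sorted_eigvals A : sorted >=%R (eigvals A).
Proof.
have ge_tr : transitive (>=%R : rel R) by apply: rev_trans; exact: le_trans.
rewrite /eigvals; set p := char_poly A.
have : sorted >=%R (rev (rootsR p)).
  by rewrite rev_sorted; apply: sub_sorted (sorted_roots _ _ _) => x y; exact: ltW.
rewrite !(sorted_pairwise ge_tr).
elim: (rev _) => [//|x s IHs] /= /andP[xs /IHs sP].
rewrite pairwise_cat sP andbT; apply/andP; split.
  apply/allrelP => a b /nseqP[-> _] /flatten_mapP[y ys /nseqP[-> _]].
  exact: (allP xs).
elim: (mup _ _) => [//|k IHk] /=; rewrite IHk andbT.
by apply/allP => b /nseqP[-> _] /=.
Qed.

Lemma char_poly_sym_split A : A^T = A ->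
  exists s : seq R, char_poly A = \prod_(x <- s) ('X - x%:P).
Proof.
move=> symA; pose f : {rmorphism R -> complex R} := real_complex R.
pose AC : 'M[complex R]_n := map_mx f A.
have hA : AC \is hermsymmx.
  apply: realsym_hermsym; last first.
    by apply/mxOverP => i j; rewrite mxE; apply/Creal_ReP; rewrite -complexRe.
  by apply/is_hermitianmxP; rewrite expr0 scale1r map_mx_id // map_trmx symA.
have /mxOverP dR := hermitian_spectral_diag_real hA.
have /orthomx_spectralP := hermitian_normalmx hA.
have := spectral_unit AC; move: (spectralmx AC) dR => P.
move: (spectral_diag AC) => D dR Pu AE.
have dE i : D 0 i = f (complex.Re (D 0 i)).
  by have /Creal_ReP := dR 0 i; rewrite -complexRe.
exists [seq complex.Re (D 0 i) | i <- enum 'I_n].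
apply: (map_poly_inj f); rewrite (map_char_poly f) -/AC.
have -> : char_poly AC = char_poly (diag_mx D).
  have PE : P *m AC = diag_mx D *m P by rewrite AE !mulmxA mulmxV // mul1mx.
  have : map_mx polyC P *m char_poly_mx AC
       = char_poly_mx (diag_mx D) *m map_mx polyC P.
    rewrite mulmxBr mulmxBl -!map_mxM /= PE; congr (_ - _).
    by rewrite scalar_mxC.
  move/(congr1 determinant); rewrite !det_mulmx mulrC => /mulIf; apply.
  by rewrite det_map_mx polyC_eq0 -unitfE -unitmxE.
rewrite char_poly_trig ?diag_mx_is_trig // big_map -big_enum rmorph_prod /=.
apply: eq_bigr => i _; rewrite mxE eqxx mulr1n dE.
by rewrite rmorphB /= map_polyX map_polyC.
Qed.

Lemma char_poly_eigvals A : A^T = A ->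
  char_poly A = \prod_(x <- eigvals A) ('X - x%:P).
Proof.
move=> /char_poly_sym_split[s sE]; rewrite sE; apply: perm_big.
apply/allP => x _; rewrite /= count_eigvals sE; apply/eqP.
elim: s {sE} => [|y s IHs] /=; first by rewrite big_nil mupNroot // root1.
rewrite big_cons mupM ?monic_neq0 ?monicXsubC ?monic_prod_XsubC // -IHs.
by rewrite -['X - _]expr1 mup_XsubCX; case: eqP.
Qed.

Lemma size_eigvals A : A^T = A -> size (eigvals A) = n.
Proof.
move=> /char_poly_eigvals /(congr1 (size \o polyseq)) /=.
by rewrite size_char_poly size_prod_XsubC => -[].
Qed.

End Eigenvalues.

Section RandomGraph.
Variables (R : realFieldType) (n : nat).

(* A simple graph on 'I_n is given by its edge set, a subset of [vpairs n]. *)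
Definition vpairs : {set {set 'I_n}} := [set e : {set 'I_n} | #|e| == 2]%SET.

(* The diagonal vanishes because [set i; i] is a singleton. *)
Definition adjmx (G : {set {set 'I_n}}) : 'M[R]_n :=
  \matrix_(i, j) ([set i; j]%SET \in G)%:R.

Definition gnp_weight (p : R) (G : {set {set 'I_n}}) : R :=
  \prod_(e in vpairs) (if e \in G then p else 1 - p).

Definition gnp_prob (p : R) (E : pred {set {set 'I_n}}) : R :=
  \sum_(G in powerset vpairs | E G) gnp_weight p G.

Lemma card_vpairs : #|vpairs| = 'C(n, 2).
Proof. by rewrite card_draws card_ord. Qed.

Lemma adjmx_sym G : (adjmx G)^T = adjmx G.
Proof. by apply/matrixP => i j; rewrite !mxE finset.setUC. Qed.

Lemma gnp_prob_total p : gnp_prob p predT = 1.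
Proof.
transitivity (\prod_(e : {set 'I_n})
  ((if e \in vpairs then p else 0) + (if e \in vpairs then 1 - p else 1))).
  rewrite bigA_distr /gnp_prob [RHS](bigID (fun G => G \in powerset vpairs)) /=.
  rewrite [X in _ = _ + X]big1 ?addr0 => [|G]; last first.
    rewrite powersetE => /fintype.subsetPn[e eG eV].
    by rewrite (bigD1 e) //= eG (negbTE eV) mul0r.
  apply: eq_big => [G|G]; rewrite ?andbT // => GV.
  rewrite /gnp_weight big_mkcond /=; apply: eq_bigr => e _.
  case: ifPn => eV //; case: ifPn => // eG; case/negP: eV.
  by move: GV; rewrite powersetE => /fintype.subsetP; apply.
by apply: big1 => e _; case: ifP => _; rewrite ?add0r // addrC subrK.
Qed.

End RandomGraph.

(* Main.v *)
(** Write [t = delta n p] and [L = ln (1/p)]; the target is [exp (- t^2 L / 2)].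

    Upper bound.  If [lambda_2 >= t], some vector [v] orthogonal to the constants has
    [v A v^T >= t |v|^2], hence the same holds for the matrix [X = A - p (J - I)] of
    centered edges.  Normalize [|v|^2 = M n] and round each coordinate of [v] to an
    adjacent integer without decreasing the form, which is affine in each coordinate
    because [X] has no diagonal.  This leaves [exp (O (n))] integer vectors [k], with
    [|k|^2 <= (1 + h) M n].  By the Kearns--Saul inequality a centered Bernoulli(p)
    variable is sub-Gaussian with variance proxy [1 / (2 L)], so each of them satisfies
    [k X k^T >= t M n] with probability at most [exp (- (1 - O (h)) t^2 L / 2)].  The
    union bound costs nothing since [n << t^2].

    Lower bound.  Compare with the law that plants a clique on [m ~ (1 + e) t] vertices
    and uses edge probability [q = p (1 + O (delta p / e))] elsewhere.  By Chernoff
    bounds the indicators of the clique and of its complement then span, with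
    probability at least 1/2, a plane on which the form is at least [t].
    Cauchy--Schwarz transfers this to [G(n,p)] at the cost of the second moment of the
    density, which is about [exp (m^2 L / 2)].  The increase of [q] over [p] offsets the
    interaction of the two vectors, which matters when [delta] is close to 1. *)

Require Import Defs.
From mathcomp Require Import all_boot all_order all_algebra.
From mathcomp Require Import complex.
From mathcomp Require Import all_classical all_reals all_analysis.
From mathcomp Require Import ring lra.

Set Implicit Arguments.
Unset Strict Implicit.
Unset Printing Implicit Defensive.

Import Order.TTheory GRing.Theory Num.Theory.
Import numFieldNormedType.Exports.

Local Open Scope classical_set_scope.
Local Open Scope ring_scope.

(** * The second eigenvalue and quadratic forms *)

Definition qform (R : realFieldType) n (A : 'M[R]_n) (v : 'I_n -> R) : R :=
  \sum_i \sum_j A i j * (v i * v j).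

Definition sqnorm (R : realFieldType) n (v : 'I_n -> R) : R := \sum_i v i ^+ 2.

(** The squared modulus is kept in [R], so that sums of such terms can be compared with real
    quadratic forms. *)
Definition cnorm2 (R : rcfType) (z : complex R) : R :=
  complex.Re z ^+ 2 + complex.Im z ^+ 2.

Section Spectral.
Variables (R : rcfType) (n : nat).
Implicit Types (A : 'M[R]_n) (z c : 'rV[complex R]_n).

Local Notation ctr M := (map_mx Num.conj (trmx M)).
Local Notation rc := (real_complex R).
Local Notation re := (@complex.Re R).
Local Notation im := (@complex.Im R).

Lemma cnorm2_ge0 (x : complex R) : 0 <= cnorm2 x.
Proof. by rewrite addr_ge0 ?sqr_ge0. Qed.

Lemma cnorm2_eq0 (x : complex R) : cnorm2 x = 0 -> x = 0.
Proof.
case: x => a b /eqP; rewrite /cnorm2 /= paddr_eq0 ?sqr_ge0 // !sqrf_eq0.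
by move=> /andP[/eqP -> /eqP ->].
Qed.

Lemma Re_sum (I : Type) (r : seq I) (P : pred I) (F : I -> complex R) :
  re (\sum_(i <- r | P i) F i) = \sum_(i <- r | P i) re (F i).
Proof. by apply: (big_morph re) => // -[a b] [c d]. Qed.

Lemma Im_sum (I : Type) (r : seq I) (P : pred I) (F : I -> complex R) :
  im (\sum_(i <- r | P i) F i) = \sum_(i <- r | P i) im (F i).
Proof. by apply: (big_morph im) => // -[a b] [c d]. Qed.

(** Since [A] is real, the cross terms between real and imaginary parts are purely imaginary. This
    is how complex vectors from the spectral theorem are brought back to real ones. *)
Lemma Re_qform A z : re ((z *m map_mx rc A *m ctr z) 0 0) =
  qform A (fun i => re (z 0 i)) + qform A (fun i => im (z 0 i)).
Proof.
rewrite mxE Re_sum /qform exchange_big [X in _ + X]exchange_big -big_split /=.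
apply: eq_bigr => j _; rewrite !mxE mulr_suml Re_sum -big_split /=.
apply: eq_bigr => i _; rewrite !mxE; case: (z 0 i) (z 0 j) => [a b] [c d] /=.
by ring.
Qed.

Lemma Re_sqnorm z : re ((z *m ctr z) 0 0) =
  sqnorm (fun i => re (z 0 i)) + sqnorm (fun i => im (z 0 i)).
Proof.
rewrite mxE Re_sum /sqnorm -big_split /=.
apply: eq_bigr => i _; rewrite !mxE; case: (z 0 i) => a b /=; ring.
Qed.

Lemma Re_diag (d : 'I_n -> R) c :
  re ((c *m diag_mx (\row_i rc (d i)) *m ctr c) 0 0) = \sum_i d i * cnorm2 (c 0 i).
Proof.
rewrite mxE Re_sum; apply: eq_bigr => i _.
rewrite mul_mx_diag !mxE /cnorm2; case: (c 0 i) => a b /=; ring.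
Qed.

(** The spectral theorem is applied over [complex R], where the diagonal of a hermitian matrix is
    real. It agrees with [eigvals] up to order because both have the multiplicities of the roots of
    [char_poly A]. *)
Lemma spectral_eigvals A : A^T = A ->
  exists (P : 'M[complex R]_n) (d : 'I_n -> R),
    [/\ P *m ctr P = 1%:M,
        map_mx rc A = ctr P *m diag_mx (\row_i rc (d i)) *m P &
        perm_eq (eigvals A) [seq d i | i <- enum 'I_n]].
Proof.
move=> symA; pose AC : 'M[complex R]_n := map_mx rc A.
have hA : AC \is hermsymmx.
  apply: realsym_hermsym; last first.
    by apply/mxOverP => i j; rewrite mxE; apply/Creal_ReP; rewrite -complexRe.
  by apply/is_hermitianmxP; rewrite expr0 scale1r map_mx_id // map_trmx symA.
have /mxOverP dR := hermitian_spectral_diag_real hA.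
have /orthomx_spectralP := hermitian_normalmx hA.
have := spectral_unitarymx AC; move: (spectralmx AC) dR => P.
move: (spectral_diag AC) => D dR Pu AE.
have dE i : D 0 i = rc (complex.Re (D 0 i)).
  by have /Creal_ReP := dR 0 i; rewrite -complexRe.
have DE : D = \row_i rc (complex.Re (D 0 i)).
  by apply/rowP => i; rewrite mxE -dE.
exists P, (fun i => complex.Re (D 0 i)).
rewrite invmx_unitary // in AE.
have PP : P *m ctr P = 1%:M by apply/unitarymxP.
split => //; first by rewrite -DE.
have chE : char_poly A = \prod_i ('X - (complex.Re (D 0 i))%:P).
  apply: (map_poly_inj rc); rewrite (map_char_poly rc) -/AC.
  have -> : char_poly AC = char_poly (diag_mx D).
    have PE : P *m AC = diag_mx D *m P by rewrite AE !mulmxA PP mul1mx.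
    have : map_mx polyC P *m char_poly_mx AC
         = char_poly_mx (diag_mx D) *m map_mx polyC P.
      rewrite mulmxBr mulmxBl -!map_mxM /= PE; congr (_ - _).
      by rewrite scalar_mxC.
    move/(congr1 determinant); rewrite !det_mulmx mulrC => /mulIf; apply.
    by rewrite det_map_mx polyC_eq0 -unitfE -unitmxE unitarymx_unit.
  rewrite char_poly_trig ?diag_mx_is_trig // rmorph_prod /=.
  apply: eq_bigr => i _; rewrite mxE eqxx mulr1n dE.
  by rewrite rmorphB /= map_polyX map_polyC.
apply/allP => x _; rewrite /= count_eigvals chE.
rewrite -big_enum -(big_map (fun i => complex.Re (D 0 i)) xpredT (fun y => 'X - y%:P)).
apply/eqP; move: [seq _ | _ <- _] => s.
elim: s => [|y s IHs] /=; first by rewrite big_nil mupNroot // root1.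
rewrite big_cons mupM ?monic_neq0 ?monicXsubC ?monic_prod_XsubC // -IHs.
by rewrite -['X - _]expr1 mup_XsubCX; case: eqP.
Qed.

(** Positivity of [t] makes the default value 0 of [lambda] harmless; otherwise the list is sorted,
    so its second entry decides. *)
Lemma lambda2_ge_count A (t : R) : 0 < t ->
  (t <= lambda 2 A) = (1 < count (>= t) (eigvals A))%N.
Proof.
move=> t0; rewrite /lambda /=; have := sorted_eigvals A.
case: (eigvals A) => [|a [|b s]] /=.
- by rewrite leNgt t0.
- by rewrite leNgt t0; case: (t <= a).
move=> /andP[ba sP]; case: (leP t b) => tb.
  by rewrite (le_trans tb ba).
suff -> : count (>= t) s = 0%N by rewrite !addn0; case: (t <= a).
apply/eqP; rewrite -leqn0 leqNgt -has_count; apply/hasPn => y ys.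
have : all (fun x => b >= x) s by apply: order_path_min sP => x1 x2 x3 /= ? /le_trans; apply.
by move=> /allP/(_ _ ys) yb; rewrite -ltNge (le_lt_trans yb).
Qed.

(** One linear equation in two unknowns has a nonzero solution: this is the dimension count behind
    both min-max arguments below. *)
Lemma kernel_pair (a b : complex R) :
  exists s t : complex R, (s != 0) || (t != 0) /\ s * a + t * b = 0.
Proof.
have [a0|a0] := eqVneq a 0.
  by exists 1, 0; rewrite oner_neq0 a0 mulr0 mul0r addr0.
by exists (- b), a; rewrite a0 orbT; split => //; ring.
Qed.

Lemma sqnorm_ge0 (v : 'I_n -> R) : 0 <= sqnorm v.
Proof. by apply: sumr_ge0 => i _; rewrite sqr_ge0. Qed.

Lemma sqnorm_eq0 (v : 'I_n -> R) : sqnorm v = 0 -> forall i, v i = 0.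
Proof.
move=> /eqP; rewrite psumr_eq0 => [/allP v0 i|i _]; last exact: sqr_ge0.
by have := v0 i; rewrite mem_index_enum sqrf_eq0 => /(_ isT)/eqP.
Qed.

Lemma qform0 A (v : 'I_n -> R) : (forall i, v i = 0) -> qform A v = 0.
Proof. by move=> v0; apply: big1 => i _; apply: big1 => j _; rewrite v0 mul0r mulr0. Qed.

(** Two eigenvectors with eigenvalues at least [t] span a plane on which the form is at least [t]
    times the squared norm. This plane meets the hyperplane orthogonal to the constants. *)
Lemma lambda2_ge_vec A (t : R) : A^T = A -> 0 < t -> t <= lambda 2 A ->
  exists v : 'I_n -> R,
    [/\ 0 < sqnorm v, \sum_i v i = 0 & t * sqnorm v <= qform A v].
Proof.
move=> symA t0; rewrite lambda2_ge_count //.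
have [P [d [PP AE /permP ->]]] := spectral_eigvals symA.
rewrite count_map => h.
have [i [j [ij di dj]]] : exists i j, [/\ i != j, t <= d i & t <= d j].
  move: h; rewrite -size_filter; set s := seq.filter _ _.
  have us : uniq s by rewrite filter_uniq // enum_uniq.
  have ps x : x \in s -> t <= d x by rewrite mem_filter => /andP[].
  case: s us ps => [|i [|j s]] //= /andP[ij _] ps _.
  exists i, j; split; [|exact/ps/mem_head|by apply: ps; rewrite !inE eqxx orbT].
  by apply: contraNneq ij => ->; rewrite mem_head.
(* The combination of rows [i] and [j] of [P] whose coordinates sum to 0. *)
have [a [b [ab0 abE]]] := kernel_pair (\sum_k P i k) (\sum_k P j k).
pose c : 'rV[complex R]_n := \row_k (a * (k == i)%:R + b * (k == j)%:R).
have cE k : c 0 k = a * (k == i)%:R + b * (k == j)%:R by rewrite mxE.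
pose z := c *m P.
have zE k : z 0 k = a * P i k + b * P j k.
  rewrite mxE (eq_bigr (fun l => a * ((l == i)%:R * P l k) + b * ((l == j)%:R * P l k))).
    2: by move=> l _; rewrite cE mulrDl -!mulrA.
  rewrite big_split /=; congr (_ + _).
    by rewrite (bigD1 i) //= eqxx mul1r big1 ?addr0 // => l /negbTE ->; rewrite mul0r mulr0.
  by rewrite (bigD1 j) //= eqxx mul1r big1 ?addr0 // => l /negbTE ->; rewrite mul0r mulr0.
have zA : z *m map_mx rc A *m ctr z = c *m diag_mx (\row_i rc (d i)) *m ctr c.
  rewrite AE /z trmx_mul map_mxM /= !mulmxA.
  rewrite -(mulmxA c P) PP mulmx1 -(mulmxA _ P (ctr P)) PP mulmx1 //.
have zN : z *m ctr z = c *m ctr c.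
  by rewrite /z trmx_mul map_mxM /= !mulmxA -(mulmxA c P) PP mulmx1.
have sN := Re_sqnorm z.
have sA := Re_qform A z.
set x := (fun i => re (z 0 i)) in sN sA.
set y := (fun i => im (z 0 i)) in sN sA.
have cN : re ((c *m ctr c) 0 0) = \sum_k cnorm2 (c 0 k).
  rewrite mxE Re_sum; apply: eq_bigr => l _; rewrite !mxE /cnorm2.
  by case: (a * _ + _) => a' b' /=; ring.
have ge : t * (sqnorm x + sqnorm y) <= qform A x + qform A y.
  rewrite -sN -sA zN zA Re_diag cN mulr_sumr; apply: ler_sum => k _.
  case: (eqVneq k i) => [->|ki]; first by rewrite ler_wpM2r ?cnorm2_ge0.
  case: (eqVneq k j) => [->|kj]; first by rewrite ler_wpM2r ?cnorm2_ge0.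
  by rewrite cE (negbTE ki) (negbTE kj) !mulr0 addr0 /cnorm2 /= expr0n addr0 !mulr0.
have pos : 0 < sqnorm x + sqnorm y.
  rewrite -sN zN cN lt_def sumr_ge0 ?andbT; last by move=> *; exact: cnorm2_ge0.
  apply/negP; rewrite psumr_eq0 => [/allP c0|*]; last exact: cnorm2_ge0.
  have c00 k : c 0 k = 0.
    by have := c0 k; rewrite mem_index_enum => /(_ isT)/eqP/cnorm2_eq0.
  have := c00 i; have := c00 j; rewrite !cE !eqxx (negbTE ij) eq_sym (negbTE ij).
  rewrite !mulr0 !mulr1 addr0 add0r => b0 a0.
  by move: ab0; rewrite a0 b0 eqxx.
have zS : \sum_k z 0 k = 0.
  under eq_bigr do rewrite zE.
  by rewrite big_split /= -!mulr_sumr abE.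
have xS : \sum_k x k = 0 by rewrite /x -Re_sum zS.
have yS : \sum_k y k = 0 by rewrite /y -Im_sum zS.
have hx := sqnorm_ge0 x; have hy := sqnorm_ge0 y.
(* The inequality holds for the real part [x] and the imaginary part [y] added together, hence for
   one of them; a part of norm 0 has form 0. *)
have [x0|x0] := eqVneq (sqnorm x) 0.
  exists y; split => //; first by move: pos; rewrite x0 add0r.
  by move: ge; rewrite x0 add0r (qform0 _ (sqnorm_eq0 x0)) add0r.
have [xge|xlt] := leP (t * sqnorm x) (qform A x).
  by exists x; split => //; rewrite lt_def x0.
have ylt : t * sqnorm y < qform A y by move: ge; rewrite mulrDr; lra.
exists y; split => //; last exact: ltW.
rewrite lt_def hy andbT; apply/eqP => y0.
by move: ylt; rewrite y0 mulr0 (qform0 _ (sqnorm_eq0 y0)) ltxx.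
Qed.

(** If at most one eigenvalue reached [t], the plane of [u] and [v] would contain a nonzero vector
    orthogonal to its eigenvector, and there the form would be below [t] times the squared norm. *)
Lemma vec_lambda2_ge A (t : R) (u v : 'I_n -> R) : A^T = A -> 0 < t ->
  (forall a b : R, (forall i, a * u i + b * v i = 0) -> a = 0 /\ b = 0) ->
  (forall a b : R, t * sqnorm (fun i => a * u i + b * v i)
     <= qform A (fun i => a * u i + b * v i)) ->
  t <= lambda 2 A.
Proof.
move=> symA t0 free ge; rewrite lambda2_ge_count // ltnNge.
have [P [d [PP AE /permP ->]]] := spectral_eigvals symA.
rewrite count_map; apply/negP => h.
have P'P : ctr P *m P = 1%:M by apply: mulmx1C.
have [i0 di0] : exists i0, forall j, j != i0 -> d j < t.
  move: h; rewrite -size_filter; set s := seq.filter _ _.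
  have ps x : t <= d x -> x \in s by rewrite mem_filter mem_enum /= andbT.
  case: s ps => [|i [|j s]] //= ps _.
    (* No eigenvalue reaches [t], so any index serves as [i0]; freeness of [u] and [v] excludes
       [n = 0]. *)
    have n0 : (0 < n)%N.
      case: n u v free {A symA t0 ge P d PP AE P'P ps} => // u v /(_ 1 0)[|/eqP].
        by case.
      by rewrite oner_eq0.
    by exists (Ordinal n0) => j _; rewrite ltNge; apply/negP => /ps.
  exists i => j ji; rewrite ltNge; apply/negP => /ps.
  by rewrite inE (negbTE ji).
pose e (w : 'I_n -> R) : 'rV[complex R]_n := \row_i rc (w i).
have [a [b [ab0 abE]]] := kernel_pair ((e u *m ctr P) 0 i0) ((e v *m ctr P) 0 i0).
pose z := a *: e u + b *: e v.
pose c := z *m ctr P.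
have ci0 : c 0 i0 = 0.
  by rewrite /c /z mulmxDl -!scalemxAl mxE [X in X + _]mxE [X in _ + X]mxE abE.
have zc : z = c *m P by rewrite /c -mulmxA P'P mulmx1.
have zA : z *m map_mx rc A *m ctr z = c *m diag_mx (\row_i rc (d i)) *m ctr c.
  rewrite AE zc trmx_mul map_mxM /= !mulmxA.
  rewrite -(mulmxA c P) PP mulmx1 -(mulmxA _ P (ctr P)) PP mulmx1 //.
have zN : z *m ctr z = c *m ctr c.
  by rewrite zc trmx_mul map_mxM /= !mulmxA -(mulmxA c P) PP mulmx1.
have sN := Re_sqnorm z.
have sA := Re_qform A z.
have cN : re ((c *m ctr c) 0 0) = \sum_k cnorm2 (c 0 k).
  rewrite mxE Re_sum; apply: eq_bigr => l _; rewrite !mxE /cnorm2.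
  by case: (\sum_j _) => a' b' /=; ring.
have zRe : (fun i => re (z 0 i)) = (fun i => re a * u i + re b * v i).
  apply: funext => i; rewrite !mxE.
  case: a {ab0 abE z c ci0 zc zA zN sN sA cN} => ? ?; case: b => ? ? /=.
  by rewrite !mulr0 !subr0.
have zIm : (fun i => im (z 0 i)) = (fun i => im a * u i + im b * v i).
  apply: funext => i; rewrite !mxE.
  case: a {ab0 abE z c ci0 zc zA zN sN sA cN zRe} => ? ?; case: b => ? ? /=.
  by rewrite !mulr0 !add0r.
have gez : t * \sum_k cnorm2 (c 0 k) <= \sum_k d k * cnorm2 (c 0 k).
  by rewrite -Re_diag -zA sA -cN -zN sN mulrDr zRe zIm lerD.
(* The component along [i0] vanishes by the choice of [a] and [b]; all other [d k] are below [t], so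
   [gez] forces the remaining components to be 0. *)
have c0 k : c 0 k = 0.
  have [->//|ki0] := eqVneq k i0.
  apply: cnorm2_eq0; apply/eqP; rewrite eq_le cnorm2_ge0 andbT.
  have : \sum_k (t - d k) * cnorm2 (c 0 k) <= 0.
    under eq_bigr do rewrite mulrBl.
    by rewrite sumrB -mulr_sumr subr_le0.
  rewrite (bigD1 k) //= => le0.
  have : 0 <= \sum_(i < n | i != k) (t - d i) * cnorm2 (c 0 i).
    apply: sumr_ge0 => l _; have [->|li0] := eqVneq l i0.
      by rewrite ci0 /cnorm2 /= expr0n addr0 mulr0.
    by rewrite mulr_ge0 ?cnorm2_ge0 // subr_ge0 ltW // di0.
  move=> S0; rewrite leNgt; apply/negP => pos.
  have : (t - d k) * cnorm2 (c 0 k) <= 0 by apply: le_trans le0; rewrite lerDl.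
  by rewrite leNgt mulr_gt0 // subr_gt0 di0.
have z0 i : z 0 i = 0.
  by rewrite zc mxE big1 // => k _; rewrite c0 mul0r.
have [ra rb] : re a = 0 /\ re b = 0.
  by apply: free => i; have /(congr1 (@^~ i)) /= <- := zRe; rewrite z0.
have [ia ib] : im a = 0 /\ im b = 0.
  by apply: free => i; have /(congr1 (@^~ i)) /= <- := zIm; rewrite z0.
move: ab0; clear -ra rb ia ib.
by case: a b ra rb ia ib => [? ?] [? ?] /= -> -> -> ->; rewrite eqxx.
Qed.

End Spectral.

(** * Independent edges *)

Section ProductMeasure.
Variables (R : realType) (n : nat).
Implicit Types (w a b c : {set 'I_n} -> R) (G : {set {set 'I_n}}) (e : {set 'I_n})
  (f g : {set {set 'I_n}} -> R).

Local Notation V := (vpairs n).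

(** Edge probabilities may vary with the edge, so that the law with a planted clique is covered
    too. *)
Definition edge_weight w (G : {set {set 'I_n}}) : R :=
  \prod_(e in V) (if e \in G then w e else 1 - w e).

Definition edge_mean w f : R := \sum_(G in powerset V) edge_weight w G * f G.

Lemma sum_powerset_prod a b :
  \sum_(G in powerset V) \prod_(e in V) (if e \in G then a e else b e) =
  \prod_(e in V) (a e + b e).
Proof.
rewrite [RHS]big_mkcond /=.
(* A set outside [V] gets the summands 0 and 1, so that distributing over all sets of sets leaves
   only the subsets of [V]. *)
transitivity (\prod_(e : {set 'I_n})
  ((if e \in V then a e else 0) + (if e \in V then b e else 1))); last first.
  by apply: eq_bigr => e _; case: ifP => _; rewrite ?add0r.
rewrite bigA_distr [RHS](bigID (fun G : {set {set 'I_n}} => G \in powerset V)) /=.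
rewrite [X in _ = _ + X]big1 ?addr0 => [|G]; last first.
  rewrite powersetE => /fintype.subsetPn[e eG eV].
  by rewrite (bigD1 e) //= eG (negbTE eV) mul0r.
apply: eq_big => [G|G]; rewrite ?andbT // => GV.
rewrite big_mkcond /=; apply: eq_bigr => e _.
case: ifPn => eV //; case: ifPn => // eG; case/negP: eV.
by move: GV; rewrite powersetE => /fintype.subsetP; apply.
Qed.

Lemma edge_mean_prod w a b :
  edge_mean w (fun G => \prod_(e in V) (if e \in G then a e else b e)) =
  \prod_(e in V) (w e * a e + (1 - w e) * b e).
Proof.
rewrite -sum_powerset_prod; apply: eq_bigr => G _.
by rewrite -big_split /=; apply: eq_bigr => e _; case: ifP.
Qed.

Lemma edge_weight_ge0 w G : (forall e, 0 <= w e <= 1) -> 0 <= edge_weight w G.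
Proof.
move=> w01; apply: prodr_ge0 => e _; have /andP[? ?] := w01 e.
by case: ifP => _ //; rewrite subr_ge0.
Qed.

Lemma edge_mean1 w : edge_mean w (fun=> 1) = 1.
Proof.
transitivity (edge_mean w (fun G => \prod_(e in V) (if e \in G then 1 else 1))).
  apply: eq_bigr => G _; rewrite big1 // => e _; by case: ifP.
by rewrite edge_mean_prod big1 // => e _; rewrite !mulr1 addrC subrK.
Qed.

(** The comparison is asked only where the weight is nonzero; under the planted law this provides
    the clique. *)
Lemma ler_edge_mean w f g : (forall e, 0 <= w e <= 1) ->
  (forall G, G \subset V -> edge_weight w G != 0 -> f G <= g G) ->
  edge_mean w f <= edge_mean w g.
Proof.
move=> w01 fg; apply: ler_sum => G; rewrite powersetE => GV.
have [->|w0] := eqVneq (edge_weight w G) 0; first by rewrite !mul0r.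
by rewrite ler_wpM2l ?edge_weight_ge0 // fg.
Qed.

Lemma edge_meanD w f g : edge_mean w (fun G => f G + g G) = edge_mean w f + edge_mean w g.
Proof. by rewrite -big_split; apply: eq_bigr => G _; rewrite mulrDr. Qed.

Lemma edge_meanZ w x f : edge_mean w (fun G => x * f G) = x * edge_mean w f.
Proof. by rewrite mulr_sumr; apply: eq_bigr => G _; rewrite mulrCA. Qed.

Lemma edge_mean_sum w (I : Type) (r : seq I) (P : pred I) (F : I -> {set {set 'I_n}} -> R) :
  edge_mean w (fun G => \sum_(i <- r | P i) F i G) =
  \sum_(i <- r | P i) edge_mean w (F i).
Proof.
rewrite exchange_big /=; apply: eq_bigr => G _.
by rewrite mulr_sumr.
Qed.

Lemma gnp_probE p (E : pred {set {set 'I_n}}) :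
  gnp_prob p E = edge_mean (fun=> p) (fun G => (E G)%:R).
Proof.
rewrite /gnp_prob big_mkcondr /=; apply: eq_bigr => G _.
by case: (E G); rewrite ?mulr1 ?mulr0.
Qed.

Lemma edge_mean_exp w c (s : R) :
  edge_mean w (fun G => expR (s * \sum_(e in V) c e * (e \in G)%:R)) =
  \prod_(e in V) (1 + w e * (expR (s * c e) - 1)).
Proof.
transitivity (edge_mean w (fun G =>
    \prod_(e in V) (if e \in G then expR (s * c e) else 1))).
  apply: eq_bigr => G _; congr (_ * _).
  rewrite mulr_sumr expR_sum; apply: eq_bigr => e _.
  by case: ifP => _; rewrite ?mulr1 // !mulr0 expR0.
by rewrite edge_mean_prod; apply: eq_bigr => e _; ring.
Qed.

(** Chernoff's bound. The event keeps the factor [s], whose sign is free, so that the lemma serves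
    upper and lower tails. *)
Lemma edge_mean_tail w c (s x : R) : (forall e, 0 <= w e <= 1) ->
  edge_mean w (fun G => (s * x <= s * \sum_(e in V) c e * (e \in G)%:R)%R%:R)
  <= expR (- (s * x)) * \prod_(e in V) (1 + w e * (expR (s * c e) - 1)).
Proof.
move=> w01; rewrite -edge_mean_exp -edge_meanZ; apply: ler_edge_mean => // G _ _.
rewrite -expRD; case: (leP (s * x)) => h; last by rewrite mulr0n expR_ge0.
by rewrite -[leLHS]expR0 ler_expR; lra.
Qed.

Lemma edge_mean_subgaussian p c (k t : R) : 0 <= p <= 1 -> 0 < k -> 0 <= t ->
  (forall s, 1 + p * (expR s - 1) <= expR (p * s + k * s ^+ 2)) ->
  forall B, 0 < B -> \sum_(e in V) c e ^+ 2 <= B ->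
  edge_mean (fun=> p) (fun G => (t <= \sum_(e in V) c e * ((e \in G)%:R - p))%R%:R)
  <= expR (- (t ^+ 2 / (4 * k * B))).
Proof.
(* This [s] minimizes [- s * t + k * s ^+ 2 * B]. *)
move=> p01 k0 t0 sg B B0 cB; pose s := t / (2 * k * B).
have kB : 0 < 2 * k * B by rewrite !mulr_gt0.
have s0 : 0 <= s by rewrite divr_ge0 // ltW.
pose m := \sum_(e in V) c e * p.
apply: (@le_trans _ _ (edge_mean (fun=> p)
    (fun G => (s * (t + m) <= s * \sum_(e in V) c e * (e \in G)%:R)%R%:R))).
  apply: ler_edge_mean => // G _ _; rewrite ler_nat.
  under eq_bigr do rewrite mulrBr; rewrite sumrB -/m.
  case: (leP t) => // h; rewrite ler_wpM2l //; lra.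
apply: le_trans (edge_mean_tail _ _ _ _) _ => //.
apply: (@le_trans _ _ (expR (- (s * (t + m))) * \prod_(e in V)
    expR (p * (s * c e) + k * (s * c e) ^+ 2))).
  rewrite ler_wpM2l ?expR_ge0 //; apply: ler_prod => e _; rewrite sg andbT.
  have /andP[p0 p1] := p01; have := expR_ge0 (s * c e) => h.
  have : 0 <= p * expR (s * c e) by rewrite mulr_ge0.
  lra.
rewrite -expR_sum -expRD ler_expR big_split /=.
have -> : \sum_(e in V) p * (s * c e) = s * m.
  by rewrite mulr_sumr; apply: eq_bigr => e _; ring.
have -> : \sum_(e in V) k * (s * c e) ^+ 2 = k * s ^+ 2 * \sum_(e in V) c e ^+ 2.
  by rewrite mulr_sumr; apply: eq_bigr => e _; ring.
have h : k * s ^+ 2 * \sum_(e in V) c e ^+ 2 <= k * s ^+ 2 * B.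
  by rewrite ler_wpM2l // mulr_ge0 ?sqr_ge0 // ltW.
have e1 : k * s ^+ 2 * B = t ^+ 2 / (4 * k * B).
  by rewrite /s; field; rewrite !gt_eqF.
have e2 : s * t = 2 * (t ^+ 2 / (4 * k * B)).
  by rewrite /s; field; rewrite !gt_eqF.
lra.
Qed.

Lemma expRB1_le (y : R) : expR y - 1 <= y * expR y.
Proof.
have h : 1 - y <= expR (- y) by exact: expR_ge1Dx.
have : (1 - y) * expR y <= expR (- y) * expR y by rewrite ler_wpM2r ?expR_ge0.
by rewrite -expRD addNr expR0; lra.
Qed.

Lemma expR_le_quad (y : R) : y <= 0 -> expR y <= 1 + y + y ^+ 2.
Proof.
move=> y0; have h1 := expRB1_le y; have h2 := expR_ge1Dx y.
have h3 : y * (expR y - 1) <= y * y by rewrite ler_wnM2l //; lra.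
rewrite expr2; lra.
Qed.

(** Coefficients go up to 2 because a quadratic form counts each edge in both orientations. *)
Lemma edge_mean_lower_tail w c (x : R) : (forall e, 0 <= w e <= 1) ->
  (forall e, 0 <= c e <= 2) -> 0 <= x ->
  forall m, m = \sum_(e in V) w e * c e -> 0 < m ->
  edge_mean w (fun G => (\sum_(e in V) c e * (e \in G)%:R <= m - x)%R%:R)
  <= expR (- (x ^+ 2 / (8 * m))).
Proof.
(* This [s] minimizes the resulting exponent [- s * x + 2 * s ^+ 2 * m]. *)
move=> w01 c02 x0 m mE m0; pose s := x / (4 * m).
have s0 : 0 <= s by rewrite divr_ge0 // mulr_ge0 // ltW.
apply: (@le_trans _ _ (edge_mean w
    (fun G => (- s * (m - x) <= - s * \sum_(e in V) c e * (e \in G)%:R)%R%:R))).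
  apply: ler_edge_mean => // G _ _; rewrite ler_nat.
  by case: (leP _ (m - x)) => // h; rewrite ler_wnM2l // oppr_le0.
apply: le_trans (edge_mean_tail _ _ _ _) _ => //.
apply: (@le_trans _ _ (expR (- (- s * (m - x))) * \prod_(e in V)
    expR (w e * c e * (- s + 2 * s ^+ 2)))).
  rewrite ler_wpM2l ?expR_ge0 //; apply: ler_prod => e _.
  have /andP[w0 w1] := w01 e; have /andP[c0 c2] := c02 e.
  have E0 := expR_ge0 (- s * c e); apply/andP; split.
    have : 0 <= w e * expR (- s * c e) by rewrite mulr_ge0.
    lra.
  apply: le_trans (expR_ge1Dx _); rewrite lerD2l -mulrA ler_wpM2l //.
  have : expR (- s * c e) <= 1 + - s * c e + (- s * c e) ^+ 2.
    by apply: expR_le_quad; rewrite mulNr oppr_le0 mulr_ge0.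
  have : s ^+ 2 * (c e * c e) <= s ^+ 2 * (c e * 2).
    by rewrite ler_wpM2l ?sqr_ge0 // ler_wpM2l.
  have -> : (- s * c e) ^+ 2 = s ^+ 2 * (c e * c e) by ring.
  lra.
rewrite -expR_sum -expRD ler_expR -mulr_suml -mE.
have e1 : s * x = 2 * (x ^+ 2 / (8 * m)) by rewrite /s; field; rewrite gt_eqF.
have e2 : s ^+ 2 * m * 2 = x ^+ 2 / (8 * m) by rewrite /s; field; rewrite gt_eqF.
lra.
Qed.

Lemma edge_mean_upper_tail w c : (forall e, 0 <= w e <= 1) ->
  (forall e, 0 <= c e <= 1) ->
  forall m, m = \sum_(e in V) w e * c e ->
  edge_mean w (fun G => (4 * m <= \sum_(e in V) c e * (e \in G)%:R)%R%:R)
  <= expR (- m).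
Proof.
(* At [s = 1/2] one has [expR (s * c e) - 1 <= c e], so the exponent is at most [- 2 * m + m]. *)
move=> w01 c01 m mE; pose s : R := 2^-1.
apply: (@le_trans _ _ (edge_mean w
    (fun G => (s * (4 * m) <= s * \sum_(e in V) c e * (e \in G)%:R)%R%:R))).
  apply: ler_edge_mean => // G _ _; rewrite ler_nat.
  by case: (leP (4 * m)) => // h; rewrite ler_wpM2l // invr_ge0.
apply: le_trans (edge_mean_tail _ _ _ _) _ => //.
apply: (@le_trans _ _ (expR (- (s * (4 * m))) * \prod_(e in V) expR (w e * c e))).
  rewrite ler_wpM2l ?expR_ge0 //; apply: ler_prod => e _.
  have /andP[w0 w1] := w01 e; have /andP[c0 c1] := c01 e.
  have E0 := expR_ge0 (s * c e); apply/andP; split.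
    have : 0 <= w e * expR (s * c e) by rewrite mulr_ge0.
    lra.
  apply: le_trans (expR_ge1Dx _); rewrite lerD2l ler_wpM2l //.
  apply: le_trans (expRB1_le _) _.
  have E2 : expR (s * c e) <= 2.
    have sc : s * c e <= s by rewrite /s; lra.
    apply: (@le_trans _ _ (expR s)); first by rewrite ler_expR.
    have := expR_ge1Dx (- s); rewrite expRN => h.
    rewrite -[2]invrK -/s -[leLHS]invrK lef_pV2 ?posrE ?invr_gt0 ?expR_gt0 //.
    by rewrite /s in h *; lra.
  have : s * c e * expR (s * c e) <= s * c e * 2.
    by rewrite ler_wpM2l // mulr_ge0 // invr_ge0.
  rewrite /s; lra.
rewrite -expR_sum -expRD ler_expR -mE /s; lra.
Qed.

(** Cauchy--Schwarz for the density of the law [w] with respect to the law [p]; the product over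
    edges is the second moment of this density. *)
Lemma edge_mean_change p w (E : pred {set {set 'I_n}}) : 0 < p < 1 ->
  edge_mean w (fun G => (E G)%:R) ^+ 2 <=
  edge_mean (fun=> p) (fun G => (E G)%:R) *
  \prod_(e in V) (w e ^+ 2 / p + (1 - w e) ^+ 2 / (1 - p)).
Proof.
move=> /andP[p0 p1].
have p1' : 0 < 1 - p by rewrite subr_gt0.
set A := edge_mean (fun=> p) _; set B := edge_mean w _; set C := \prod_(e in V) _.
have Wp G : 0 < edge_weight (fun=> p) G by apply: prodr_gt0 => e _; case: ifP.
have CE : C = \sum_(G in powerset V) edge_weight w G ^+ 2 / edge_weight (fun=> p) G.
  rewrite /C -sum_powerset_prod; apply: eq_bigr => G _.
  rewrite /edge_weight -prodrXl -prodf_div; apply: eq_bigr => e _.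
  by case: ifP.
(* This quadratic is the mean under [p] of the square of [x] times the indicator of [E] minus the
   density. *)
have quad x : 0 <= A * x ^+ 2 - 2 * x * B + C.
  rewrite CE /A /B /edge_mean mulr_suml mulr_sumr -sumrB -big_split /=.
  apply: sumr_ge0 => G _; have P0 := Wp G.
  set P := edge_weight _ G in P0 *; set W := edge_weight _ G.
  have Pn : P != 0 by rewrite gt_eqF.
  have C0 : 0 <= W ^+ 2 / P by rewrite divr_ge0 ?sqr_ge0 // ltW.
  case: (E G); rewrite ?mulr1 ?mulr0 ?mul0r ?subr0 ?add0r //.
  have -> : P * x ^+ 2 - 2 * x * W + W ^+ 2 / P = P * (x - W / P) ^+ 2.
    by field.
  by rewrite mulr_ge0 ?sqr_ge0 // ltW.
have A0 : 0 <= A.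
  by apply: sumr_ge0 => G _; rewrite mulr_ge0 // ltW.
have [A00|An] := eqVneq A 0.
  have [->|Bn] := eqVneq B 0; first by rewrite A00 mul0r expr0n.
  (* With [A = 0] the polynomial is affine, and at this point it equals -1. *)
  have := quad ((C + 1) / (2 * B)); rewrite A00 mul0r.
  have -> : 2 * ((C + 1) / (2 * B)) * B = C + 1 by field.
  by lra.
have Ap : 0 < A by rewrite lt_def An.
(* The minimizer of the quadratic. *)
have := quad (B / A).
have -> : A * (B / A) ^+ 2 - 2 * (B / A) * B + C = (A * C - B ^+ 2) / A by field.
by rewrite pmulr_lge0 ?invr_gt0 // subr_ge0.
Qed.

(** Collecting the two orientations of [e] turns a sum over ordered pairs, whose terms repeat each
    edge, into a sum over independent edges. *)
Definition pair_sum (F : 'I_n -> 'I_n -> R) e : R :=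
  \sum_(x : 'I_n * 'I_n | (x.2 != x.1) && ([set x.1; x.2]%SET == e)) F x.1 x.2.

Lemma pair_sumE e : e \in V -> exists i j,
  [/\ j != i, e = [set i; j]%SET & forall F, pair_sum F e = F i j + F j i].
Proof.
rewrite inE => /cards2P[i [j [ij eE]]]; rewrite eq_sym in ij.
exists i, j; split => // F; rewrite /pair_sum.
rewrite (bigD1 (i, j)) /=; last by rewrite ij eE eqxx.
rewrite (bigD1 (j, i)) /=; last first.
  apply/andP; split; first by rewrite eq_sym ij eE finset.setUC eqxx.
  by apply: contraNneq ij => -[->].
rewrite big1 ?addr0 // => -[a b] /= /andP[/andP[/andP[ba /eqP ab] n1] n2].
exfalso; rewrite eE in ab.
have ha : a \in [set i; j]%SET by rewrite -ab !inE eqxx.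
have hb : b \in [set i; j]%SET by rewrite -ab !inE eqxx orbT.
move: ha hb ba n1 n2; rewrite !inE !xpair_eqE.
by move=> /orP[] /eqP -> /orP[] /eqP ->; rewrite !eqxx.
Qed.

Lemma sum_pairs (F : 'I_n -> 'I_n -> R) (g : {set 'I_n} -> R) :
  \sum_i \sum_(j | j != i) F i j * g [set i; j]%SET =
  \sum_(e in V) pair_sum F e * g e.
Proof.
rewrite pair_big_dep /=.
rewrite (partition_big (fun x : 'I_n * 'I_n => [set x.1; x.2]%SET) (fun e => e \in V)) /=.
  apply: eq_bigr => e _; rewrite /pair_sum mulr_suml.
  by apply: eq_big => [x|x /andP[_ /eqP <-]].
by move=> [i j] /= ij; rewrite inE cards2 [i == j]eq_sym ij.
Qed.

Lemma pair_sum_sqr (k : 'I_n -> R) :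
  \sum_(e in V) pair_sum (fun i j => k i * k j) e ^+ 2 <= 2 * sqnorm k ^+ 2.
Proof.
(* The square [4 * k i ^+ 2 * k j ^+ 2] is shared equally by the two orientations; restoring the
   diagonal then gives the full product. *)
apply: (@le_trans _ _ (\sum_(e in V)
   pair_sum (fun i j => 2 * (k i ^+ 2 * k j ^+ 2)) e * 1)).
  apply: ler_sum => e /pair_sumE[i [j [_ _ H]]]; rewrite !H.
  by rewrite le_eqVlt; apply/orP; left; apply/eqP; ring.
rewrite -(sum_pairs _ (fun=> 1)) /sqnorm expr2 mulr_suml mulr_sumr.
apply: ler_sum => i _; rewrite mulr_sumr mulr_sumr.
rewrite [leRHS](bigID (fun j => j != i)) /= -[leLHS]addr0 lerD //.
  by apply: ler_sum => j _; rewrite mulr1.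
by apply: sumr_ge0 => j _; apply: mulr_ge0 => //; apply: mulr_ge0; exact: sqr_ge0.
Qed.

(** The quadratic form of [A - p (J - I)], with [J] the all-ones matrix. *)
Definition centered_form p (G : {set {set 'I_n}}) (k : 'I_n -> R) : R :=
  \sum_i \sum_(j | j != i) k i * k j * (([set i; j]%SET \in G)%:R - p).

Lemma centered_form_tail p (k : 'I_n -> R) (c t : R) :
  0 <= p <= 1 -> 0 < c -> 0 <= t ->
  (forall s, 1 + p * (expR s - 1) <= expR (p * s + c * s ^+ 2)) ->
  forall B, 0 < B -> sqnorm k <= B ->
  edge_mean (fun=> p) (fun G => (t <= centered_form p G k)%R%:R)
  <= expR (- (t ^+ 2 / (8 * c * B ^+ 2))).
Proof.
move=> p01 c0 t0 sg B B0 kB.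
have -> : 8 * c * B ^+ 2 = 4 * c * (2 * B ^+ 2) by ring.
rewrite (_ : (fun G => _) = (fun G => (t <= \sum_(e in V)
    pair_sum (fun i j => k i * k j) e * ((e \in G)%:R - p))%R%:R)); last first.
  by apply/funext => G; rewrite -(sum_pairs _ (fun e => (e \in G)%:R - p)).
apply: edge_mean_subgaussian => //; first by rewrite mulr_gt0 ?exprn_gt0.
apply: le_trans (pair_sum_sqr k) _; rewrite ler_wpM2l // lerXn2r ?nnegrE ?sqnorm_ge0 //.
exact: ltW.
Qed.

End ProductMeasure.

(** * The upper bound *)

Section UpperTail.
Variables (R : realType) (n : nat).
Implicit Types (G : {set {set 'I_n}}) (v k : 'I_n -> R).

Local Notation V := (vpairs n).

(* The constant is optimal up to [eps]: the quadratic [s ^+ 2 / (4 * L)] is tangent to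
   [s - L] at [s = 2 * L]. *)
Lemma bernoulli_subgaussian (p eps : R) : 0 < p < 1 -> 0 < eps ->
  let L := ln (1 / p) in 64 <= L -> 16 <= eps * L ->
  forall s, 1 + p * (expR s - 1) <= expR (p * s + (1 + eps) / (4 * L) * s ^+ 2).
Proof.
move=> /andP[p0 p1] e0 L L64 eL s.
have L0 : 0 < L by lra.
have pE : p = expR (- L).
  by rewrite /L div1r lnV ?posrE // opprK lnK ?posrE.
(* [r] is the square root of [p]. It lies below the target coefficient, which settles all [s] up to
   [L / 2]. *)
pose r := expR (- (L / 2)).
have r0 : 0 < r by exact: expR_gt0.
have pr : p = r * r by rewrite pE -expRD; congr expR; lra.
have rL : r * (4 * L) <= 1.
  have h4 : L / 4 <= expR (L / 4) by have := expR_ge1Dx (L / 4); lra.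
  have h2 : expR (L / 2) = expR (L / 4) * expR (L / 4).
    by rewrite -expRD; congr expR; lra.
  have h : L / 4 * (L / 4) <= expR (L / 2) by rewrite h2 ler_pM //; lra.
  apply: (@le_trans _ _ (r * expR (L / 2))); last by rewrite -expRD addNr expR0.
  rewrite ler_wpM2l ?(ltW r0) //; apply: le_trans h.
  have : 64 * L <= L * L by rewrite ler_wpM2r // ltW.
  lra.
set k := (1 + eps) / (4 * L).
have kE : k * (4 * L) = 1 + eps by rewrite /k divfK // gt_eqF // mulr_gt0.
have rk : r <= k.
  have : r * (4 * L) <= k * (4 * L) by lra.
  by rewrite ler_pM2r // mulr_gt0.
have s2 : 0 <= s ^+ 2 by exact: sqr_ge0.
have [s0|s0] := leP s 0.
  apply: le_trans (expR_ge1Dx _) _; rewrite ler_expR.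
  have h : p * (expR s - 1) <= p * (s + s ^+ 2).
    by rewrite ler_wpM2l ?(ltW p0) //; have := expR_le_quad s0; lra.
  apply: (le_trans h); rewrite mulrDr lerD2l ler_wpM2r //.
  apply: le_trans rk; rewrite pr ler_piMl ?(ltW r0) // /r.
  by rewrite -[leRHS]expR0 ler_expR; lra.
(* In this range [p * expR s <= r]. *)
have [sL|sL] := leP s (L / 2).
  apply: le_trans (expR_ge1Dx _) _; rewrite ler_expR.
  have h1 : expR s - 1 <= s * expR s := expRB1_le s.
  have h2 : s * (expR s - 1) <= s * (s * expR s) by rewrite ler_wpM2l // ltW.
  have h3 : p * (expR s - 1) <= p * (s + s ^+ 2 * expR s).
    rewrite ler_wpM2l ?(ltW p0) // expr2; move: h1 h2; nra.
  apply: (le_trans h3); rewrite mulrDr lerD2l.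
  have -> : p * (s ^+ 2 * expR s) = p * expR s * s ^+ 2 by ring.
  rewrite ler_wpM2r //; apply: le_trans rk.
  rewrite pr -mulrA ler_piMr ?(ltW r0) // /r -expRD -[leRHS]expR0 ler_expR; lra.
(* For larger [s] the tangency [s - L <= q] bounds the exponential term by [expR q], and
   [eps * q >= 1] pays for the factor 2 that the summand 1 costs. *)
have p1' : 1 + p * (expR s - 1) <= 1 + expR (s - L).
  by rewrite lerD2l expRB -expRN -pE; lra.
apply: (le_trans p1').
have e2 : (2 : R) <= expR 1 by have := expR_ge1Dx (1 : R); lra.
have ps0 : 0 <= p * s by rewrite mulr_ge0 ?(ltW p0) // ltW.
have kk : k * s ^+ 2 = s ^+ 2 / (4 * L) + eps * (s ^+ 2 / (4 * L)).
  by rewrite /k; field; rewrite gt_eqF.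
set q := s ^+ 2 / (4 * L) in kk.
have q16 : L / 16 <= q.
  rewrite /q ler_pdivlMr ?mulr_gt0 //.
  have : L / 2 * (L / 2) <= s * s by rewrite ler_pM //; lra.
  rewrite expr2; lra.
have qs : s - L <= q.
  rewrite /q ler_pdivlMr ?mulr_gt0 //.
  have := sqr_ge0 (s - 2 * L); rewrite !expr2; lra.
have eq1 : 1 <= eps * q.
  have : eps * (L / 16) <= eps * q by rewrite ler_wpM2l // ltW.
  lra.
have a1 : 1 <= expR q by rewrite -[leLHS]expR0 ler_expR; lra.
have a2 : expR (s - L) <= expR q by rewrite ler_expR.
apply: (@le_trans _ _ (expR 1 * expR q)).
  have : 2 * expR q <= expR 1 * expR q by rewrite ler_wpM2r ?expR_ge0.
  lra.
by rewrite -expRD ler_expR kk; lra.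
Qed.

Definition upd v (a : 'I_n) (x : R) : 'I_n -> R := fun i => if i == a then x else v i.

(* The form has no diagonal terms, so it is affine in each coordinate. *)
Lemma centered_form_upd p G v a x :
  centered_form p G (upd v a x) = centered_form p G v +
    (x - v a) * \sum_(j | j != a)
      v j * ((([set a; j]%SET \in G)%:R - p) + (([set j; a]%SET \in G)%:R - p)).
Proof.
rewrite /centered_form (bigD1 a) //= [X in _ = X + _](bigD1 a) //=.
set m := fun i j => ([set i; j]%SET \in G)%:R - p.
have -> : \sum_(j < n | j != a) upd v a x a * upd v a x j * m a j =
    \sum_(j < n | j != a) v a * v j * m a j + (x - v a) * \sum_(j < n | j != a) v j * m a j.
  rewrite mulr_sumr -big_split /=; apply: eq_bigr => j /negbTE ja.
  by rewrite /upd eqxx ja; ring.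
have -> : \sum_(i < n | i != a) \sum_(j < n | j != i) upd v a x i * upd v a x j * m i j =
    \sum_(i < n | i != a) \sum_(j < n | j != i) v i * v j * m i j +
    (x - v a) * \sum_(j < n | j != a) v j * m j a.
  rewrite mulr_sumr -big_split /=; apply: eq_bigr => i ia.
  rewrite (bigD1 a) 1?eq_sym //= [X in _ = X + _](bigD1 a) 1?eq_sym //=.
  rewrite (eq_bigr (fun j => v i * v j * m i j)) => [|j /andP[_ /negbTE ja]].
    by rewrite /upd eqxx (negbTE ia); ring.
  by rewrite /upd ja (negbTE ia).
rewrite [X in _ = _ + _ * X](eq_bigr (fun j => v j * m a j + v j * m j a)) => [|j _].
  by rewrite big_split /=; ring.
by rewrite mulrDr.
Qed.

(** Coordinates are rounded one at a time, up or down according to the sign of the slope of the form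
    in that coordinate. *)
Lemma centered_form_round p G v : exists k : 'I_n -> int,
  (forall i, `|(k i)%:~R - v i| <= 1) /\
  centered_form p G v <= centered_form p G (fun i => (k i)%:~R).
Proof.
(* In the induction, coordinates outside the list still agree with [v], so the next move starts from
   [v a]. *)
suff [w [wP _ le]] : exists w : 'I_n -> R,
    [/\ forall i, i \in enum 'I_n -> exists z : int, w i = z%:~R /\ `|w i - v i| <= 1,
        forall i, i \notin enum 'I_n -> w i = v i &
        centered_form p G v <= centered_form p G w].
  have /choice[k kP] : forall i, exists z : int, w i = z%:~R /\ `|w i - v i| <= 1.
    by move=> i; apply: wP; rewrite mem_enum.
  exists k; have kE : w = (fun i => (k i)%:~R) by apply/funext => i; case: (kP i).
  by rewrite -kE; split => // i; have [<-] := kP i.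
elim: (enum 'I_n) => [|a s [w [wP wN le]]]; first by exists v; split.
have [as_|as_] := boolP (a \in s).
  exists w; split => // i; first by rewrite inE => /orP[/eqP->|]; apply: wP.
  by rewrite inE negb_or => /andP[_]; apply: wN.
have wa := wN a as_.
have /andP[f1 f2] : (Num.floor (v a))%:~R <= v a < (Num.floor (v a) + 1)%:~R.
  exact: floor_itv.
set f := Num.floor (v a) in f1 f2.
have [z [zv zle]] : exists z : int, `|z%:~R - v a| <= 1 /\
    centered_form p G w <= centered_form p G (upd w a z%:~R).
  have f2' := f2; rewrite intrD in f2'.
  set S := \sum_(j | j != a)
      w j * ((([set a; j]%SET \in G)%:R - p) + (([set j; a]%SET \in G)%:R - p)).
  have [S0|S0] := leP 0 S.
    (* Rounding up means floor plus 1 even at an integer; the distance is still at most 1. *)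
    exists (f + 1); rewrite ler_norml; split; first by rewrite intrD; lra.
    by rewrite centered_form_upd -/S wa lerDl mulr_ge0 // subr_ge0 ltW.
  exists f; rewrite ler_norml; split; first lra.
  by rewrite centered_form_upd -/S wa lerDl mulr_le0 ?(ltW S0) // subr_le0.
exists (upd w a z%:~R); split; last exact: le_trans zle.
  move=> i; rewrite inE /upd; have [->|ia] := eqVneq i a; first by exists z.
  exact: wP.
move=> i; rewrite inE negb_or /upd => /andP[/negbTE ->]; exact: wN.
Qed.

(** On vectors of zero sum the all-ones matrix contributes nothing, and the missing diagonal returns
    [p * sqnorm v]. *)
Lemma centered_form_qform p G v : G \subset V -> \sum_i v i = 0 ->
  centered_form p G v = qform (adjmx R G) v + p * sqnorm v.
Proof.
move=> GV v0.
have e1 i : \sum_(j | j != i) v i * v j * (([set i; j]%SET \in G)%:R - p) =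
    \sum_j adjmx R G i j * (v i * v j) - p * (v i * (\sum_j v j)) + p * v i ^+ 2.
  rewrite [X in X - _](bigD1 i) //= [\sum_j v j](bigD1 i) //= mxE.
  have -> : ([set i; i]%SET \in G) = false.
    apply/negP => /(fintype.subsetP GV); rewrite inE cards2 eqxx //.
  have -> : \sum_(j | j != i) v i * v j * (([set i; j]%SET \in G)%:R - p) =
      \sum_(j | j != i) adjmx R G i j * (v i * v j) - p * (v i * \sum_(j | j != i) v j).
    rewrite mulr_sumr mulr_sumr -sumrB; apply: eq_bigr => j _.
    by rewrite mxE; ring.
  by rewrite mul0r; ring.
rewrite /centered_form; under eq_bigr do rewrite e1 v0 !mulr0 subr0.
by rewrite big_split /= -mulr_sumr.
Qed.

Lemma sum_half_geo K : \sum_(i < K) (2^-1 : R) ^+ i <= 2.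
Proof.
suff -> : \sum_(i < K) (2^-1 : R) ^+ i = 2 - 2 * 2^-1 ^+ K.
  by rewrite gerBl mulr_ge0 // exprn_ge0.
elim: K => [|K IH]; first by rewrite big_ord0 expr0; lra.
by rewrite big_ord_recr /= IH exprS; lra.
Qed.

(** Each vector counted has weight [2 ^+ N] times [2^-1] to its total size at least 1. The sum of
    these weights factors into [2 * n] geometric series, each at most 2. The pairs encode positive
    and negative parts of integers. *)
Lemma card_small_vectors K N :
  \sum_(a : {ffun 'I_n -> 'I_K * 'I_K} | (\sum_i ((a i).1 + (a i).2) <= N)%N) 1
  <= 2 ^+ N * 4 ^+ n :> R.
Proof.
apply: (@le_trans _ _ (\sum_(a : {ffun 'I_n -> 'I_K * 'I_K})
    2 ^+ N * \prod_i (2^-1 ^+ (a i).1 * 2^-1 ^+ (a i).2))).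
  rewrite [leRHS](bigID (fun a : {ffun 'I_n -> 'I_K * 'I_K} =>
    (\sum_i ((a i).1 + (a i).2) <= N)%N)) /=.
  rewrite -[leLHS]addr0 lerD //.
    apply: ler_sum => a aN; under eq_bigr do rewrite -exprD.
    rewrite prodrXr exprVn ler_pdivlMr ?exprn_gt0 // mul1r.
    by rewrite ler_weXn2l // ler1n.
  apply: sumr_ge0 => a _; rewrite mulr_ge0 ?exprn_ge0 //.
  by apply: prodr_ge0 => i _; rewrite mulr_ge0 // exprn_ge0 // invr_ge0.
rewrite -mulr_sumr ler_wpM2l ?exprn_ge0 //.
rewrite -(bigA_distr_bigA (fun (i : 'I_n) (x : 'I_K * 'I_K) =>
   (2^-1 : R) ^+ x.1 * 2^-1 ^+ x.2)) /=.
rewrite prodr_const card_ord lerXn2r ?nnegrE //.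
  by apply: sumr_ge0 => x _; rewrite mulr_ge0 // exprn_ge0 // invr_ge0.
rewrite -(pair_bigA _ (fun i j : 'I_K => (2^-1 : R) ^+ i * 2^-1 ^+ j)) /=.
under eq_bigr do rewrite -mulr_sumr; rewrite -mulr_suml.
have -> : (4 : R) = 2 * 2 by lra.
have g0 : 0 <= \sum_(i < K) (2^-1 : R) ^+ i.
  by apply: sumr_ge0 => i _; rewrite exprn_ge0 // invr_ge0.
by rewrite ler_pM // sum_half_geo.
Qed.

(** The cross term is split as [2 x d <= (h/2) x^2 + (2/h) d^2]. The errors add up to at most
    [(1 + 2 / h) * n], which [M] is large enough to absorb. *)
Lemma sqnorm_round v k (h : R) (M : nat) : 0 < h -> 1 + 2 / h <= h / 2 * M%:R ->
  sqnorm v = (M * n)%:R -> (forall i, `|k i - v i| <= 1) ->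
  sqnorm k <= (1 + h) * (M * n)%:R.
Proof.
move=> h0 hM vE kv.
apply: (@le_trans _ _ (\sum_i ((1 + h / 2) * v i ^+ 2 + (1 + 2 / h)))).
  apply: ler_sum => i _; have := kv i; rewrite -[k i](subrK (v i)) addrK.
  move: (k i - v i) => d; move: (v i) => x; rewrite ler_norml => /andP[d1 d1'].
  have d2 : d ^+ 2 <= 1.
    have : 0 <= (1 - d) * (1 + d) by rewrite mulr_ge0 //; lra.
    rewrite expr2; lra.
  have : 0 <= (h / 2) * (x - 2 / h * d) ^+ 2 by rewrite mulr_ge0 ?sqr_ge0 // divr_ge0 // ltW.
  have -> : h / 2 * (x - 2 / h * d) ^+ 2 = h / 2 * x ^+ 2 - 2 * x * d + 2 / h * d ^+ 2.
    by field; rewrite gt_eqF.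
  have : (1 + 2 / h) * d ^+ 2 <= (1 + 2 / h) * 1.
    by rewrite ler_wpM2l // addr_ge0 // divr_ge0 // ltW.
  have -> : (d + x) ^+ 2 = d ^+ 2 + 2 * x * d + x ^+ 2 by ring.
  lra.
rewrite big_split /= -mulr_sumr -/(sqnorm v) vE sumr_const card_ord -[_ *+ n]mulr_natr.
rewrite natrM; have := ler_wpM2r (ler0n R n) hM; lra.
Qed.

(** The vector orthogonal to the constants is scaled to squared norm [M * n] and rounded; the extra
    term [p * sqnorm v] has the favourable sign and is dropped. *)
Lemma lambda2_lattice_witness p G (t h : R) (M : nat) : 0 <= p -> (0 < n)%N ->
  G \subset V -> 0 < t -> 0 < h <= 1 -> 1 + 2 / h <= h / 2 * M%:R ->
  t <= lambda 2 (adjmx R G) ->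
  exists2 a : {ffun 'I_n -> 'I_(2 * M * n).+1 * 'I_(2 * M * n).+1},
    (\sum_i ((a i).1 + (a i).2) <= 2 * M * n)%N &&
      (sqnorm (fun i => (a i).1%:R - (a i).2%:R) <= (1 + h) * (M * n)%:R) &
    t * (M * n)%:R <= centered_form p G (fun i => (a i).1%:R - (a i).2%:R).
Proof.
move=> p0 n0 GV t0 /andP[h0 h1] hM tl.
have [u [u0 uS ut]] := lambda2_ge_vec (adjmx_sym R G) t0 tl.
have M0 : 0 < M%:R :> R.
  rewrite lt_def ler0n andbT; apply/negP => /eqP M0; move: hM; rewrite M0 mulr0.
  have : 0 < 2 / h by rewrite divr_gt0.
  lra.
have Mn0 : 0 < (M * n)%:R :> R by rewrite natrM mulr_gt0 // ltr0n.
pose r := Num.sqrt ((M * n)%:R / sqnorm u).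
have r2 : r ^+ 2 = (M * n)%:R / sqnorm u by rewrite sqr_sqrtr // divr_ge0 // ltW.
pose v i := r * u i.
have vN : sqnorm v = (M * n)%:R.
  rewrite /sqnorm; under eq_bigr do rewrite /v exprMn.
  by rewrite -mulr_sumr r2 divfK // gt_eqF.
have vS : \sum_i v i = 0 by rewrite -mulr_sumr uS mulr0.
have vq : qform (adjmx R G) v = r ^+ 2 * qform (adjmx R G) u.
  rewrite /qform mulr_sumr; apply: eq_bigr => i _.
  by rewrite mulr_sumr; apply: eq_bigr => j _; rewrite /v; ring.
have vt : t * (M * n)%:R <= centered_form p G v.
  rewrite centered_form_qform // vq -vN.
  have -> : sqnorm v = r ^+ 2 * sqnorm u by rewrite vN r2 divfK // gt_eqF.
  have : r ^+ 2 * (t * sqnorm u) <= r ^+ 2 * qform (adjmx R G) u.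
    by rewrite ler_wpM2l // sqr_ge0.
  have : 0 <= p * (r ^+ 2 * sqnorm u).
    by rewrite mulr_ge0 // mulr_ge0 ?sqr_ge0 // ltW.
  lra.
have [k [kv kc]] := centered_form_round p G v.
have kN := sqnorm_round h0 hM vN kv.
(* For integers the absolute value is at most the square, so the norm bound also controls the sum of
   absolute values. *)
have kA : (\sum_i `|k i|%N <= 2 * M * n)%N.
  rewrite -(ler_nat R) natr_sum; apply: (@le_trans _ _ (sqnorm (fun i => (k i)%:~R : R))).
    apply: ler_sum => i _.
    have -> : (k i)%:~R ^+ 2 = ((`|k i| ^ 2)%N)%:R :> R.
      by rewrite natrX natr_absz intr_norm -normrX ger0_norm ?sqr_ge0.
    by rewrite ler_nat; case: `|k i|%N => // m; rewrite expnS expn1 leq_pmulr.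
  apply: (le_trans kN); rewrite -mulnA [X in _ <= X]natrM ler_wpM2r ?ler0n //; lra.
have kb i : (`|k i| < (2 * M * n).+1)%N.
  by rewrite ltnS (leq_trans _ kA) // (bigD1 i) //= leq_addr.
pose a : {ffun 'I_n -> 'I_(2 * M * n).+1 * 'I_(2 * M * n).+1} :=
  [ffun i => if k i >= 0 then (inord `|k i|, ord0) else (ord0, inord `|k i|)].
have aE : (fun i => (a i).1%:R - (a i).2%:R) = (fun i => (k i)%:~R : R).
  apply/funext => i; rewrite ffunE; case: ifP => ki /=; rewrite inordK ?kb //.
    by rewrite subr0 pmulrn gez0_abs.
  by rewrite sub0r pmulrn ltz0_abs ?mulrNz ?opprK // ltNge ki.
exists a; last by rewrite aE (le_trans vt).
rewrite aE kN andbT; apply: leq_trans kA; apply: leq_sum => i _.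
by rewrite ffunE; case: ifP => _ /=; rewrite inordK ?kb // ?addn0.
Qed.

(** Union bound over the lattice vectors. The scale [M * n] enters the threshold and the norm bound
    alike, and cancels in the exponent. *)
Lemma gnp_lambda2_upper (p t c h : R) (M : nat) : 0 <= p <= 1 -> (0 < n)%N ->
  0 < t -> 0 < c -> 0 < h <= 1 -> 1 + 2 / h <= h / 2 * M%:R ->
  (forall s, 1 + p * (expR s - 1) <= expR (p * s + c * s ^+ 2)) ->
  gnp_prob p [pred G : {set {set 'I_n}} | t <= lambda 2 (adjmx R G)] <=
  2 ^+ (2 * M * n) * 4 ^+ n * expR (- (t ^+ 2 / (8 * c * (1 + h) ^+ 2))).
Proof.
move=> p01 n0 t0 c0 h01 hM sg; have /andP[h0 h1] := h01.
have M0 : 0 < M%:R :> R.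
  rewrite lt_def ler0n andbT; apply/negP => /eqP M0; move: hM; rewrite M0 mulr0.
  have : 0 < 2 / h by rewrite divr_gt0.
  lra.
have Mn0 : 0 < (M * n)%:R :> R by rewrite natrM mulr_gt0 // ltr0n.
set N := (2 * M * n)%N; pose B := (1 + h) * (M * n)%:R.
have B0 : 0 < B by rewrite mulr_gt0 //; lra.
pose kk (a : {ffun 'I_n -> 'I_N.+1 * 'I_N.+1}) (i : 'I_n) : R := (a i).1%:R - (a i).2%:R.
pose S (a : {ffun 'I_n -> 'I_N.+1 * 'I_N.+1}) :=
  (\sum_i ((a i).1 + (a i).2) <= N)%N && (sqnorm (kk a) <= B).
pose T := t * (M * n)%:R.
apply: (@le_trans _ _ (edge_mean (fun=> p) (fun G =>
    \sum_(a | S a) (T <= centered_form p G (kk a))%R%:R))).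
  rewrite gnp_probE; apply: ler_edge_mean => // G GV _ /=.
  case: (boolP (t <= lambda 2 _)) => [tl|_]; last by rewrite sumr_ge0.
  have /andP[p0 _] := p01.
  have [a aS aT] := lambda2_lattice_witness p0 n0 GV t0 h01 hM tl.
  by rewrite (bigD1 a) //= -/(kk a) aT lerDl sumr_ge0.
rewrite edge_mean_sum.
apply: (@le_trans _ _ (\sum_(a | S a) 1 * expR (- (t ^+ 2 / (8 * c * (1 + h) ^+ 2))))).
  apply: ler_sum => a /andP[_ aB]; rewrite mul1r.
  apply: le_trans (centered_form_tail p01 c0 _ sg B0 aB) _; first by rewrite mulr_ge0 ?ltW.
  rewrite ler_expR /T /B lerN2 le_eqVlt; apply/orP; left; apply/eqP; field.
  have h2 : 0 < 1 + h by lra.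
  have n0' : 0 < n%:R :> R by rewrite ltr0n.
  by rewrite !gt_eqF.
rewrite -mulr_suml ler_wpM2r ?expR_ge0 //.
apply: le_trans (card_small_vectors N.+1 N); rewrite /S big_mkcondr /=.
by apply: ler_sum => a _; case: ifP.
Qed.

End UpperTail.

(** * The lower bound *)

Section LowerTail.
Variables (R : realType) (n m : nat).
Hypotheses (m0 : (0 < m)%N) (mn : (m < n)%N).
Implicit Types (G : {set {set 'I_n}}) (e : {set 'I_n}).

Local Notation V := (vpairs n).

Definition planted : {set 'I_n} := [set i : 'I_n | (i < m)%N]%SET.
Definition planted_weight (q : R) e : R := if e \subset planted then 1 else q.

Local Notation S := planted.
Local Notation u := (fun i : 'I_n => (i \in S)%:R : R).
Local Notation v := (fun i : 'I_n => (i \notin S)%:R : R).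
(** Edge coefficients of the form on the plane of [u] and [v]: inside the clique, inside its
    complement, and across. The first two count an edge twice, the last once. *)
Local Notation cX := (pair_sum (fun i j => u i * u j)).
Local Notation cY := (pair_sum (fun i j => v i * v j)).
Local Notation cZ := (pair_sum (fun i j => u i * v j)).

Lemma card_planted : #|S| = m.
Proof.
rewrite -sum1_card (eq_bigl (fun i : 'I_n => (i < m)%N)) => [|i]; last by rewrite inE.
by rewrite (big_ord_narrow (ltnW mn)) sum1_card card_ord.
Qed.

Lemma sum_in_planted : \sum_i u i = m%:R.
Proof.
rewrite -[in RHS]card_planted -sum1_card natr_sum [in RHS]big_mkcond /=.
by apply: eq_bigr => i _; case: (i \in S).
Qed.

Lemma sum_notin_planted : \sum_i v i = n%:R - m%:R.
Proof.
have -> : n%:R = \sum_(i < n) 1 :> R by rewrite sumr_const card_ord.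
rewrite -sum_in_planted -sumrB.
by apply: eq_bigr => i _; case: (i \in S); rewrite ?subrr ?subr0.
Qed.

Lemma pair_sum_out (F : 'I_n -> 'I_n -> R) e : e \notin V -> pair_sum F e = 0.
Proof.
move=> eV; rewrite /pair_sum big_pred0 // => -[i j] /=.
apply/negbTE/negP => /andP[ij /eqP eE]; case/negP: eV.
by rewrite -eE inE cards2 [i == j]eq_sym ij.
Qed.

Lemma cX_E e : e \in V -> cX e = 2 * (e \subset S)%:R.
Proof.
move=> /(pair_sumE R)[i [j [_ -> ->]]]; rewrite finset.subUset !finset.sub1set.
by case: (i \in S); case: (j \in S); rewrite /= ?mulr0 ?mul0r; lra.
Qed.

Lemma cY_bounds e : 0 <= cY e <= 2.
Proof.
have [/(pair_sumE R)[i [j [_ _ ->]]]|eV] := boolP (e \in V).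
  2: by rewrite pair_sum_out //; lra.
by case: (i \in S); case: (j \in S) => /=; lra.
Qed.

Lemma cZ_bounds e : 0 <= cZ e <= 1.
Proof.
have [/(pair_sumE R)[i [j [_ _ ->]]]|eV] := boolP (e \in V).
  2: by rewrite pair_sum_out //; lra.
by case: (i \in S); case: (j \in S) => /=; lra.
Qed.

Lemma mean_cY q : \sum_(e in V) planted_weight q e * cY e =
  q * ((n%:R - m%:R) * (n%:R - m%:R - 1)).
Proof.
transitivity (\sum_(e in V) cY e * q).
  apply: eq_bigr => e /(pair_sumE R)[i [j [_ -> ->]]].
  rewrite /planted_weight finset.subUset !finset.sub1set.
  by case: (i \in S); case: (j \in S); rewrite /= ?mulr0 ?mul0r; lra.
rewrite -(sum_pairs _ (fun=> q)) /= -sum_notin_planted.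
rewrite mulrBr mulr1 {1}mulr_suml mulrBr mulr_sumr mulr_sumr -sumrB.
apply: eq_bigr => i _; rewrite [in RHS](bigD1 i) //= -mulr_suml -mulr_sumr.
by case: (i \in S) => /=; ring.
Qed.

Lemma mean_cZ q : \sum_(e in V) planted_weight q e * cZ e =
  q * (m%:R * (n%:R - m%:R)).
Proof.
transitivity (\sum_(e in V) cZ e * q).
  apply: eq_bigr => e /(pair_sumE R)[i [j [_ -> ->]]].
  rewrite /planted_weight finset.subUset !finset.sub1set.
  by case: (i \in S); case: (j \in S); rewrite /= ?mulr0 ?mul0r; lra.
rewrite -(sum_pairs _ (fun=> q)) /= -sum_notin_planted -sum_in_planted.
rewrite mulr_suml mulr_sumr.
apply: eq_bigr => i _; rewrite [in RHS](bigD1 i) //= -mulr_suml -mulr_sumr.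
by case: (i \in S) => /=; ring.
Qed.

Lemma sum_cX : \sum_(e in V) cX e = m%:R * (m%:R - 1).
Proof.
under eq_bigr do rewrite -[cX _]mulr1.
rewrite -(sum_pairs _ (fun=> 1)) /= -sum_in_planted.
rewrite mulrBr mulr1 {1}mulr_suml -sumrB.
apply: eq_bigr => i _; rewrite [in RHS](bigD1 i) //= -mulr_suml -mulr_sumr.
by case: (i \in S) => /=; ring.
Qed.

Lemma qform_edges G (k : 'I_n -> R) : G \subset V ->
  qform (adjmx R G) k = \sum_(e in V) pair_sum (fun i j => k i * k j) e * (e \in G)%:R.
Proof.
move=> GV; rewrite -(sum_pairs _ (fun e => (e \in G)%:R)); apply: eq_bigr => i _.
rewrite (bigD1 i) //= mxE; have -> : ([set i; i]%SET \in G) = false.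
  by apply/negP => /(fintype.subsetP GV); rewrite inE cards2 eqxx.
rewrite mul0r add0r; apply: eq_bigr => j _; by rewrite mxE mulrC.
Qed.

(** On the plane of [u] and [v], the form minus [t] times the squared norm is a binary quadratic
    form. The last hypothesis says that its determinant is nonnegative. *)
Lemma planted_lambda2 G (t : R) : G \subset V ->
  (forall e, e \in V -> e \subset S -> e \in G) -> 0 < t -> t < m%:R - 1 ->
  (\sum_(e in V) cZ e * (e \in G)%:R) ^+ 2 <=
    m%:R * (m%:R - 1 - t) * (\sum_(e in V) cY e * (e \in G)%:R - t * (n%:R - m%:R)) ->
  t <= lambda 2 (adjmx R G).
Proof.
move=> GV cl t0 tm; set Z := \sum_(e in V) cZ e * _; set Y := \sum_(e in V) cY e * _.
move=> ZY.
have XE : \sum_(e in V) cX e * (e \in G)%:R = m%:R * (m%:R - 1).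
  rewrite -sum_cX; apply: eq_bigr => e eV; rewrite cX_E //.
  by have [/(cl e eV) ->|_] := boolP (e \subset S); rewrite ?mulr0 ?mul0r ?mulr1.
have uv i : u i * v i = 0 by case: (i \in S); rewrite ?mulr0 ?mul0r.
apply: (vec_lambda2_ge (u := u) (v := v)) => //; first exact: adjmx_sym.
  move=> a b ab; split.
    have := ab (Ordinal (ltn_trans m0 mn)); by rewrite !inE /= m0 mulr1 mulr0 addr0.
  by have := ab (Ordinal mn); rewrite !inE /= ltnn mulr1 mulr0 add0r.
move=> a b.
have -> : sqnorm (fun i => a * u i + b * v i) = a ^+ 2 * m%:R + b ^+ 2 * (n%:R - m%:R).
  rewrite -sum_notin_planted -sum_in_planted !mulr_sumr -big_split /=.
  by apply: eq_bigr => i _; case: (i \in S) => /=; ring.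
rewrite qform_edges //.
have -> : \sum_(e in V) pair_sum (fun i j => (a * u i + b * v i) * (a * u j + b * v j)) e
     * (e \in G)%:R = a ^+ 2 * (m%:R * (m%:R - 1)) + 2 * a * b * Z + b ^+ 2 * Y.
  rewrite -XE /Z /Y !mulr_sumr -!big_split /=; apply: eq_bigr => e eV.
  have [i [j [_ _ H]]] := pair_sumE R eV; rewrite !H; ring.
set M := m%:R in tm ZY *; have M0 : 0 < M by rewrite ltr0n.
set N := n%:R - M in ZY *.
pose D := M * (M - 1 - t); have D0 : 0 < D by rewrite mulr_gt0 // subr_gt0.
rewrite -subr_ge0.
(* Completing the square in [a]. *)
have -> : a ^+ 2 * (M * (M - 1)) + 2 * a * b * Z + b ^+ 2 * Y
    - t * (a ^+ 2 * M + b ^+ 2 * N) =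
    ((D * a + b * Z) ^+ 2 + b ^+ 2 * (D * (Y - t * N) - Z ^+ 2)) / D.
  by rewrite /D; field; rewrite ?gt_eqF //; lra.
apply: divr_ge0; last exact: ltW.
by rewrite addr_ge0 ?sqr_ge0 // mulr_ge0 ?sqr_ge0 // subr_ge0.
Qed.

Lemma planted_change_factor (p q : R) : 0 < p < 1 ->
  \prod_(e in V) (planted_weight q e ^+ 2 / p + (1 - planted_weight q e) ^+ 2 / (1 - p))
  <= expR (m%:R ^+ 2 / 2 * ln (1 / p) + n%:R ^+ 2 / 2 * ((q - p) ^+ 2 / (p * (1 - p)))).
Proof.
move=> /andP[p0 p1]; have p1' : 0 < 1 - p by rewrite subr_gt0.
set L := ln _; set x := (q - p) ^+ 2 / _.
have x0 : 0 <= x by rewrite divr_ge0 ?sqr_ge0 // mulr_ge0 // ltW.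
have L0 : 0 <= L by rewrite ln_ge0 // div1r invf_ge1 // ltW.
(* A clique edge contributes [1 / p = expR L], any other edge [1 + x]. The factor [expR x] is
   granted to all edges; [cX] is 2 on clique edges, hence [L / 2]. *)
apply: (@le_trans _ _ (\prod_(e in V) expR (cX e * (L / 2) + x))).
  apply: ler_prod => e eV; apply/andP; split.
    by rewrite addr_ge0 // divr_ge0 ?sqr_ge0 // ltW.
  rewrite cX_E // /planted_weight; case: ifP => _ /=.
    rewrite expr1n subrr expr0n mul0r addr0 div1r.
    have -> : 2 * 1 * (L / 2) + x = L + x by lra.
    rewrite expRD /L lnK ?posrE ?divr_gt0 // div1r ler_peMr ?invr_ge0 ?(ltW p0) //.
    by rewrite -[leLHS]expR0 ler_expR.
  rewrite mulr0 mul0r add0r; apply: le_trans (expR_ge1Dx _).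
  rewrite /x le_eqVlt; apply/orP; left; apply/eqP; field.
  by rewrite !gt_eqF.
rewrite -expR_sum ler_expR big_split /= -mulr_suml sum_cX lerD //.
  have : m%:R * (L / 2) <= m%:R * m%:R * (L / 2).
    by rewrite ler_wpM2r ?divr_ge0 // -natrM ler_nat leq_pmulr.
  have : 0 <= m%:R * (L / 2) by rewrite mulr_ge0 // divr_ge0.
  rewrite expr2; lra.
rewrite sumr_const -[_ *+ _]mulr_natl ler_wpM2r //.
rewrite card_vpairs ler_pdivlMr // -natrM -natrX ler_nat bin2.
rewrite muln2 -[leqRHS]mulnn (leq_trans (leq_addl (odd (n * n.-1)) _)) //.
by rewrite odd_double_half leq_mul2l leq_pred orbT.
Qed.

(** Under the planted law, the complement having fewer than [(1 - s) * mY] edges (counted twice) and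
    the crossing edges exceeding [4 * mZ] each have probability at most 1/4. Outside these events
    the determinant condition holds, so the law gives mass at least 1/2, and the change of measure
    squares it. *)
Lemma gnp_lambda2_lower (p q t s : R) : 0 < p < 1 -> 0 < q <= 1 -> 0 < t ->
  t < m%:R - 1 -> 0 <= s ->
  let mY := q * ((n%:R - m%:R) * (n%:R - m%:R - 1)) in
  let mZ := q * (m%:R * (n%:R - m%:R)) in
  (4 * mZ) ^+ 2 <= m%:R * (m%:R - 1 - t) * (mY * (1 - s) - t * (n%:R - m%:R)) ->
  4 <= s ^+ 2 * mY / 8 -> 4 <= mZ ->
  4^-1 <= gnp_prob p [pred G : {set {set 'I_n}} | t <= lambda 2 (adjmx R G)] *
    expR (m%:R ^+ 2 / 2 * ln (1 / p) + n%:R ^+ 2 / 2 * ((q - p) ^+ 2 / (p * (1 - p)))).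
Proof.
move=> p01 /andP[q0 q1] t0 tm s0 mY mZ hyp hY hZ.
have /andP[p0 p1] := p01.
set E := [pred G | _].
have w01 e : 0 <= planted_weight q e <= 1.
  by rewrite /planted_weight; case: ifP => _; rewrite ?ler01 ?lexx // (ltW q0).
pose fY G := (\sum_(e in V) cY e * (e \in G)%:R <= mY - s * mY)%R%:R : R.
pose fZ G := (4 * mZ <= \sum_(e in V) cZ e * (e \in G)%:R)%R%:R : R.
have mY0 : 0 < mY.
  rewrite lt_def; apply/andP; split.
    by apply/eqP => mY0; move: hY; rewrite mY0 mulr0 mul0r; lra.
  rewrite mulr_ge0 ?(ltW q0) // mulr_ge0 // ?subr_ge0 ?ler_nat ?(ltnW mn) //.
  by rewrite lerBrDr nat1r ler_nat.
have quarter (x : R) : 4 <= x -> expR (- x) <= 4^-1.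
  move=> x4; rewrite expRN lef_pV2 ?posrE ?expR_gt0 //.
  by have := expR_ge1Dx x; lra.
have bY : edge_mean (planted_weight q) fY <= 4^-1.
  have c02 e := cY_bounds e.
  apply: le_trans (edge_mean_lower_tail w01 c02 _ (esym (mean_cY q)) mY0) _.
    by rewrite mulr_ge0 // ltW.
  apply: quarter; have -> : (s * mY) ^+ 2 / (8 * mY) = s ^+ 2 * mY / 8; last by [].
  by field; rewrite gt_eqF.
have bZ : edge_mean (planted_weight q) fZ <= 4^-1.
  by apply: le_trans (edge_mean_upper_tail w01 cZ_bounds (esym (mean_cZ q))) _; apply: quarter.
have half : 2^-1 <= edge_mean (planted_weight q) (fun G => (E G)%:R).
  have : edge_mean (planted_weight q) (fun=> 1) <=
      edge_mean (planted_weight q) (fun G => (E G)%:R + (fY G + fZ G)).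
    apply: ler_edge_mean => // G GV wG.
    rewrite /fY /fZ; case: (leP _ (mY - s * mY)) => hy; first by rewrite addrCA lerDl addr_ge0.
    case: (leP (4 * mZ)) => hz; first by rewrite !addrA lerDr addr_ge0.
    rewrite !addr0 /E /=; suff -> : t <= lambda 2 (adjmx R G) by [].
    apply: planted_lambda2 => //.
      (* A graph missing a clique edge has weight 0. *)
      move=> e eV eS; apply: contraNT wG => eG.
      by rewrite /edge_weight (bigD1 e) //= (negbTE eG) /planted_weight eS subrr mul0r.
    have cz0 : 0 <= \sum_(e in V) cZ e * (e \in G)%:R.
      by apply: sumr_ge0 => e _; rewrite mulr_ge0 //; have /andP[] := cZ_bounds e.
    apply: (@le_trans _ _ ((4 * mZ) ^+ 2)).
      by rewrite lerXn2r ?nnegrE // ?(ltW hz) // mulr_ge0 //; lra.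
    apply: (le_trans hyp); rewrite ler_wpM2l ?mulr_ge0 ?subr_ge0 ?(ltW tm) //.
    by rewrite lerD2r; lra.
  rewrite edge_mean1 !edge_meanD; lra.
have := edge_mean_change (planted_weight q) E p01.
rewrite -gnp_probE => ch.
apply: (@le_trans _ _ (edge_mean (planted_weight q) (fun G => (E G)%:R) ^+ 2)).
  have -> : 4^-1 = 2^-1 ^+ 2 :> R by field.
  by rewrite lerXn2r ?nnegrE ?invr_ge0 // (le_trans _ half) // invr_ge0.
apply: (le_trans ch); rewrite ler_wpM2l ?planted_change_factor //.
rewrite gnp_probE; apply: sumr_ge0 => G _.
by rewrite mulr_ge0 // edge_weight_ge0 // => e; rewrite !ltW.
Qed.

End LowerTail.

(** * Asymptotics *)

(* With [k = 136 * p / e], the gap needs [k <= 1 - d + 2 * d * k], which is affine in [d]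
   and true at [d = 0] and [d = 1]; this dictates the choice of [q]. *)
Lemma planted_gap (R : realFieldType) (e N p d M : R) :
  let t := d * N * p in let q := p * (1 + 272 * d * p / e) in
  0 < e <= 10^-1 -> 0 < p -> 2000 * p <= e -> 0 < d < 1 -> 0 < N ->
  N * (1 - 3 * p) <= N - M - 1 ->
  [/\ p <= q, q <= 2 * p & 128 * p ^+ 2 * N <= e * (q * (N - M - 1) * (1 - p) - t)].
Proof.
move=> t q /andP[e0 e1] p0 pe /andP[d0 d1] N0 NM.
(* Here 136 is 128 for the target plus 8 for the loss [8 * p] in [low]. *)
pose k := 136 * p / e.
have ke : e * k = 136 * p by rewrite /k; field; rewrite gt_eqF.
have k0 : 0 <= k by rewrite divr_ge0 ?(ltW e0) // mulr_ge0 // ltW.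
have k1 : 2 * k <= 1.
  have -> : 2 * k = 272 * p / e by rewrite /k; clear; lra.
  by rewrite ler_pdivrMr // mul1r; clear -p0 pe; lra.
have dk : d * k <= k by rewrite ler_piMl // ltW.
have dk0 : 0 <= d * k by rewrite mulr_ge0 // ltW.
pose y := 2 * (d * k).
have qy : q = p * (1 + y) by rewrite /q /y /k; field; rewrite gt_eqF.
have [y0 y1] : 0 <= y /\ y <= 1 by rewrite /y; clear -dk dk0 k1; split; lra.
have d1k : k <= 1 - d + y.
  have : 0 <= (1 - d) * (1 - k) + d * k.
    by rewrite addr_ge0 // mulr_ge0 // subr_ge0 ?(ltW d1) //; clear -k0 k1; lra.
  by rewrite /y; clear; lra.
have py0 : 0 <= p * y by rewrite mulr_ge0 // ltW.
have py1 : p * y <= p by rewrite ler_piMr // ltW.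
have Np0 : 0 < N * p by rewrite mulr_gt0.
have pq : p <= q by rewrite qy mulrDr mulr1 lerDl.
split => //; first by rewrite qy mulrDr mulr1 mulr_natl mulr2n lerD2l.
have p1 : 0 <= 1 - p by clear -e1 p0 pe; lra.
have low : N * p * (1 - d + y - 8 * p) <= q * (N - M - 1) * (1 - p) - t.
  have h1 : q * (N * (1 - 3 * p)) * (1 - p) <= q * (N - M - 1) * (1 - p).
    by rewrite ler_wpM2r // ler_wpM2l // (le_trans _ pq) // ltW.
  have -> : t = N * p * d by rewrite /t; ring.
  have h2 : N * p * ((1 + y) * (1 - 4 * p)) <= q * (N * (1 - 3 * p)) * (1 - p).
    have -> : q * (N * (1 - 3 * p)) * (1 - p) =
      N * p * ((1 + y) * (1 - 4 * p + 3 * p ^+ 2)) by rewrite qy; ring.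
    rewrite ler_wpM2l ?(ltW Np0) // ler_wpM2l //; first by rewrite addr_ge0.
    by rewrite lerDl mulr_ge0 // sqr_ge0.
  have h3 : N * p * (1 + y - 8 * p) <= N * p * ((1 + y) * (1 - 4 * p)).
    by rewrite ler_wpM2l ?(ltW Np0) //; clear -py1; lra.
  have -> : N * p * (1 - d + y - 8 * p) = N * p * (1 + y - 8 * p) - N * p * d by ring.
  by clear -h1 h2 h3; lra.
apply: (@le_trans _ _ (e * (N * p * (1 - d + y - 8 * p)))); last first.
  by rewrite ler_wpM2l // ltW.
have -> : 128 * p ^+ 2 * N = N * p * (128 * p) by ring.
have -> : e * (N * p * (1 - d + y - 8 * p)) = N * p * (e * (1 - d + y - 8 * p)) by ring.
rewrite ler_wpM2l ?(ltW Np0) // mulrBr.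
have h1 : e * k <= e * (1 - d + y) by rewrite ler_wpM2l // ltW.
have h2 : e * (8 * p) <= 1 * (8 * p).
  by rewrite ler_wpM2r ?mulr_ge0 ?(ltW p0) //; clear -e1; lra.
by clear -h1 h2 ke; lra.
Qed.

(** The hypotheses of [gnp_lambda2_lower] with [s = p]. In the first, the common factor
    [M * (N - M)] cancels; the left side is then at most [t * (128 * p ^+ 2 * N)] by [q <= 2 * p]
    and [M <= 2 * t], and on the right [M - 1 - t >= e * t]. *)
Lemma planted_conditions (R : realFieldType) (e N p q t M : R) :
  0 < e -> 0 < p <= 6^-1 -> p <= q <= 2 * p -> 8 <= t -> t <= N * p ->
  (1 + e) * t + 1 <= M <= 2 * t -> 128 <= p ^+ 3 * N ^+ 2 ->
  N * (1 - 3 * p) <= N - M - 1 ->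
  128 * p ^+ 2 * N <= e * (q * (N - M - 1) * (1 - p) - t) ->
  [/\ (4 * (q * (M * (N - M)))) ^+ 2 <=
        M * (M - 1 - t) * (q * ((N - M) * (N - M - 1)) * (1 - p) - t * (N - M)),
      4 <= p ^+ 2 * (q * ((N - M) * (N - M - 1))) / 8 &
      4 <= q * (M * (N - M))].
Proof.
move=> e0 /andP[p0 p6] /andP[pq q2] t8 tNp /andP[mt M2t] pn NM low.
have t0 : 0 < t by clear -t8; lra.
have N0 : 0 < N by rewrite -(pmulr_lgt0 _ p0); apply: lt_le_trans tNp.
have NMh : N / 2 <= N - M - 1.
  have : N * p <= N * 6^-1 by rewrite ler_wpM2l // ltW.
  by move: NM; rewrite mulrBr mulr1 mulrCA; clear; lra.
have N2 : 0 <= N / 2 by rewrite divr_ge0 // ltW.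
have NM0 : 0 <= N - M by clear -NMh N2; lra.
have M0 : 0 <= M by have : 0 < e * t := mulr_gt0 e0 t0; clear -mt t0; lra.
have gap : e * t <= M - 1 - t by clear -mt; lra.
have q0 : 0 <= q by rewrite (le_trans _ pq) // ltW.
have q2p : q ^+ 2 <= 4 * p ^+ 2.
  have -> : 4 * p ^+ 2 = (2 * p) ^+ 2 by ring.
  by rewrite lerXn2r ?nnegrE // mulr_ge0 // ltW.
split.
- set W := q * (N - M - 1) * (1 - p) - t in low.
  have -> : (4 * (q * (M * (N - M)))) ^+ 2 =
      M * (N - M) * (16 * q ^+ 2 * (M * (N - M))) by ring.
  have -> : M * (M - 1 - t) * (q * ((N - M) * (N - M - 1)) * (1 - p) - t * (N - M)) =
     M * (N - M) * ((M - 1 - t) * W) by rewrite /W; ring.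
  rewrite ler_wpM2l ?mulr_ge0 //.
  apply: (@le_trans _ _ (t * (128 * p ^+ 2 * N))).
    have -> : t * (128 * p ^+ 2 * N) = 16 * (4 * p ^+ 2) * (2 * t * N) by ring.
    apply: ler_pM; rewrite ?ler_wpM2l ?ler0n //.
    - by rewrite mulr_ge0 ?sqr_ge0.
    - by rewrite mulr_ge0.
    - by apply: ler_pM => //; rewrite gerBl.
  have W0 : 0 <= W.
    rewrite -(pmulr_rge0 _ e0); apply: le_trans low.
    by rewrite mulr_ge0 ?(ltW N0) // mulr_ge0 // sqr_ge0.
  apply: (@le_trans _ _ (e * t * W)); last by rewrite ler_wpM2r.
  have -> : e * t * W = t * (e * W) by ring.
  by rewrite ler_wpM2l // ltW.
- apply: (@le_trans _ _ (p ^+ 3 * N ^+ 2 / 32)); first by clear -pn; lra.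
  have -> : p ^+ 3 * N ^+ 2 / 32 = p ^+ 2 * (p * ((N / 2) * (N / 2))) / 8 by field.
  rewrite ler_wpM2r ?invr_ge0 // ler_wpM2l ?sqr_ge0 //.
  apply: ler_pM (ltW p0) (mulr_ge0 N2 N2) pq _.
  by apply: ler_pM => //; clear -NMh; lra.
- apply: (@le_trans _ _ (p * (1 * (N / 2)))); first by clear -t8 tNp; lra.
  apply: ler_pM (ltW p0) (mulr_ge0 ler01 N2) pq _; apply: ler_pM => //.
    by have : 0 < e * t := mulr_gt0 e0 t0; clear -mt t0; lra.
  by clear -NMh; lra.
Qed.

(** The clique costs [(1 + 2 * e) ^+ 2] times the target. As [q - p] is of order [d * p ^+ 2 / e],
    the background costs [t ^+ 2] times a multiple of [p / e ^+ 2], below [e] times the target for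
    such small [p]. *)
Lemma planted_cost (R : realFieldType) (e N p d M L : R) :
  let t := d * N * p in let q := p * (1 + 272 * d * p / e) in
  0 < e <= 10^-1 -> 0 < p -> p <= e ^+ 3 / (2 * 272 ^+ 2) -> p <= 2^-1 -> 0 < t ->
  0 <= M <= (1 + 2 * e) * t -> 1 <= L ->
  M ^+ 2 / 2 * L + N ^+ 2 / 2 * ((q - p) ^+ 2 / (p * (1 - p))) <=
  (1 + 9 * e) * (t ^+ 2 * L / 2).
Proof.
move=> t q /andP[e0 e1] p0 pe p2 t0 /andP[M0 Mt] L1.
have T20 : 0 <= t ^+ 2 by exact: sqr_ge0.
have p1 : 0 < 1 - p by clear -p2; lra.
have e30 : 0 < e ^+ 3 by rewrite exprn_gt0.
have xD : N ^+ 2 / 2 * ((q - p) ^+ 2 / (p * (1 - p))) <= e * (t ^+ 2 * L / 2).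
  have -> : N ^+ 2 / 2 * ((q - p) ^+ 2 / (p * (1 - p))) =
      t ^+ 2 * (272 ^+ 2 * p / (e ^+ 2 * (1 - p) * 2)).
    by rewrite /t /q; field; rewrite !gt_eqF.
  have -> : e * (t ^+ 2 * L / 2) = t ^+ 2 * (e * L / 2) by ring.
  rewrite ler_wpM2l // ler_pdivrMr; last first.
    by rewrite !mulr_gt0 ?exprn_gt0.
  apply: (@le_trans _ _ (e ^+ 3 * (1 * 2^-1))).
    have K0 : (0 : R) < 2 * 272 ^+ 2 := mulr_gt0 (ltr0n _ 2) (exprn_gt0 2 (ltr0n _ 272)).
    move: pe; rewrite (ler_pdivlMr _ _ K0).
    by move: (272 : R) => c; clear; lra.
  have -> : e * L / 2 * (e ^+ 2 * (1 - p) * 2) = e ^+ 3 * (L * (1 - p)) by field.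
  by rewrite ler_wpM2l ?(ltW e30) // ler_pM //; clear -p2; lra.
have MD : M ^+ 2 / 2 * L <= (1 + 8 * e) * (t ^+ 2 * L / 2).
  have -> : (1 + 8 * e) * (t ^+ 2 * L / 2) = (1 + 8 * e) * t ^+ 2 / 2 * L by ring.
  rewrite ler_wpM2r ?ler_wpM2r ?invr_ge0 // ?(le_trans _ L1) //.
  apply: (@le_trans _ _ (((1 + 2 * e) * t) ^+ 2)).
    by rewrite lerXn2r ?nnegrE // (le_trans M0).
  rewrite exprMn ler_wpM2r //.
  have : e * e <= e * 10^-1 by rewrite ler_wpM2l // ltW.
  by rewrite expr2; clear -e0; lra.
by move: xD MD; move: (t ^+ 2 * L / 2) => D; clear; lra.
Qed.

Lemma gnp_lambda2_lower_exp (R : realType) (n : nat) (p d e : R) :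
  let t := d * n%:R * p in let L := ln (1 / p) in
  0 < e <= 10^-1 -> 0 < p -> p <= e ^+ 3 / (2 * 272 ^+ 2) -> 0 < d < 1 ->
  8 <= t -> 2 <= e * t -> 128 <= p ^+ 3 * n%:R ^+ 2 -> 1 <= L ->
  expR (- ((1 + 10 * e) * (t ^+ 2 * L / 2))) <=
  gnp_prob p [pred G : {set {set 'I_n}} | t <= lambda 2 (adjmx R G)].
Proof.
move=> t L /[dup] e01 /andP[e0 e1] p0 pe /[dup] d01 /andP[d0 d1] t8 et pn L1.
have e2 : e * e <= e * 10^-1 by rewrite ler_wpM2l // ltW.
have pe' : 2000 * p <= e.
  have K0 : (0 : R) < 2 * 272 ^+ 2 := mulr_gt0 (ltr0n _ 2) (exprn_gt0 2 (ltr0n _ 272)).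
  move: pe; rewrite (ler_pdivlMr _ _ K0) => pe.
  have h1 : (32 : R) * 32 <= 272 ^+ 2 by rewrite expr2 ler_pM // ler_nat.
  have h2 : p * (32 * 32) <= p * 272 ^+ 2 by rewrite ler_wpM2l // ltW.
  have h3 : e * (e * e) <= e * 1 by rewrite ler_wpM2l ?(ltW e0) //; clear -e1 e2; lra.
  have h4 : e ^+ 3 = e * (e * e) by ring.
  by move: pe h2; rewrite h4; move: (272 ^+ 2) => c; clear -h3 p0; lra.
have t0 : 0 < t by clear -t8; lra.
have N0 : 0 < n%:R :> R.
  rewrite ltr0n lt0n; apply: contraTneq t0 => n0.
  by rewrite /t n0 mulr0 mul0r ltxx.
have tNp : t <= n%:R * p by rewrite /t -mulrA ler_piMl ?mulr_ge0 ?(ltW d1) // ltW.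
(* Adding 2 to the truncation gives [(1 + e) * t < m - 1], while [2 <= e * t] keeps [m] below
   [(1 + 2 * e) * t]. *)
pose m := (Num.truncn ((1 + e) * t)).+2.
have et0 : 0 <= (1 + e) * t by rewrite mulr_ge0 ?(ltW t0) // addr_ge0 // ltW.
have [m1 m2] : m%:R - 2 <= (1 + e) * t /\ (1 + e) * t < m%:R - 1.
  have /andP[h1 h2] := truncn_itv et0.
  rewrite /m -addn2 natrD; move: h1 h2; rewrite -natr1 => h1 h2.
  by clear -h1 h2; split; lra.
set q := p * (1 + 272 * d * p / e).
have mE : (1 + e) * t + 1 <= m%:R by clear -m2; lra.
have M2e : m%:R <= (1 + 2 * e) * t by clear -m1 et; lra.
have M2t : m%:R <= 2 * t.
  apply: (le_trans M2e); rewrite ler_wpM2r ?(ltW t0) //; clear -e1; lra.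
have p6 : p <= 6^-1 by clear -pe' e1 e0; lra.
have Np6 : n%:R * p <= n%:R * 6^-1 by rewrite ler_wpM2l.
have mn : (m < n)%N by rewrite -(ltr_nat R); clear -M2t tNp Np6 N0; lra.
have NM : n%:R * (1 - 3 * p) <= n%:R - m%:R - 1.
  by clear -M2t tNp t8; lra.
have [pq q2 low] := planted_gap e01 p0 pe' d01 N0 NM.
have p61 : 0 < p <= 6^-1 by rewrite p0.
have pq2 : p <= q <= 2 * p by rewrite pq.
have mt2 : (1 + e) * t + 1 <= m%:R <= 2 * t by rewrite mE.
have [c1 c2 c3] := planted_conditions e0 p61 pq2 t8 tNp mt2 pn NM low.
have p01 : 0 < p < 1 by rewrite p0 /=; clear -p6; lra.
have q01 : 0 < q <= 1 by rewrite (lt_le_trans p0 pq) /= (le_trans q2) //; clear -p6; lra.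
have tm : t < m%:R - 1 by apply: le_lt_trans m2; rewrite mulrDl mul1r lerDl mulr_ge0 // ltW.
have HP := gnp_lambda2_lower (isT : (0 < m)%N) mn p01 q01 t0 tm (ltW p0) c1 c2 c3.
have p2 : p <= 2^-1 by clear -p6; lra.
have m02 : (0 : R) <= m%:R <= (1 + 2 * e) * t by rewrite ler0n.
have cost := planted_cost e01 p0 pe p2 t0 m02 L1.
move: HP cost; rewrite -/t -/q -/L; set P := gnp_prob _ _.
set X := _ + _ => HP; set D := t ^+ 2 * L / 2 => cost.
(* One more [e * D] in the exponent absorbs the constant 1/4. *)
have D4 : 4 <= e * D.
  have h1 : 2 * 8 <= e * t * t by apply: ler_pM.
  have h2 : e * t * t * 1 <= e * t * t * L.
    by rewrite ler_wpM2l // !mulr_ge0 // ltW.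
  by rewrite /D expr2; clear -h1 h2; lra.
have h4 : expR (- (e * D)) <= 4^-1.
  rewrite expRN lef_pV2 ?posrE ?expR_gt0 //.
  by have := expR_ge1Dx (e * D); clear -D4; lra.
have P0 : 0 <= P.
  have : 0 < P * expR X by apply: lt_le_trans HP; rewrite invr_gt0.
  by rewrite pmulr_lgt0 ?expR_gt0 // => /ltW.
have : P * expR X <= P * expR ((1 + 9 * e) * D) by rewrite ler_wpM2l // ler_expR.
move=> /(le_trans HP)/(le_trans h4).
rewrite -ler_pdivrMr ?expR_gt0 // -expRN -expRD; apply: le_trans.
by rewrite ler_expR; clear; lra.
Qed.

(** The sub-Gaussian constant and the rounding together cost [(1 + h) ^+ 3], which is at most a loss
    of [3 * h]; the number of lattice vectors costs one more [h]. *)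
Lemma gnp_lambda2_upper_exp (R : realType) (n M : nat) (p t h : R) :
  let L := ln (1 / p) in
  0 < p < 1 -> (0 < n)%N -> 0 < t -> 0 < h <= 1 -> 1 + 2 / h <= h / 2 * M%:R ->
  64 <= L -> 16 <= h * L -> (2 * M + 2)%:R * n%:R <= h * (t ^+ 2 * L / 2) ->
  gnp_prob p [pred G : {set {set 'I_n}} | t <= lambda 2 (adjmx R G)] <=
  expR (- ((1 - 4 * h) * (t ^+ 2 * L / 2))).
Proof.
move=> L p01 n0 t0 h01 hM L64 hL hn; have /andP[h0 h1] := h01; have /andP[p0 p1] := p01.
have L0 : 0 < L by lra.
have p01' : 0 <= p <= 1 by rewrite !ltW.
have c0 : 0 < (1 + h) / (4 * L) by rewrite divr_gt0 ?mulr_gt0 //; lra.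
apply: le_trans (gnp_lambda2_upper p01' n0 t0 c0 h01 hM
  (bernoulli_subgaussian p01 h0 L64 hL)) _.
set D := t ^+ 2 * L / 2 in hn *.
have D0 : 0 <= D by rewrite mulr_ge0 // mulr_ge0 ?sqr_ge0 // ltW.
have -> : t ^+ 2 / (8 * ((1 + h) / (4 * L)) * (1 + h) ^+ 2) = D / (1 + h) ^+ 3.
  by rewrite /D; field; rewrite !gt_eqF //; lra.
have e2 : (2 : R) <= expR 1 by have := expR_ge1Dx (1 : R); lra.
have -> : (4 : R) ^+ n = 2 ^+ (2 * n) by rewrite exprM; congr (_ ^+ _); ring.
rewrite -exprD -mulnDl.
apply: (@le_trans _ _ (expR (h * D) * expR (- (D / (1 + h) ^+ 3)))).
  rewrite ler_wpM2r ?expR_ge0 //.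
  apply: (@le_trans _ _ (expR ((2 * M + 2)%:R * n%:R))); last by rewrite ler_expR.
  by rewrite -natrM -[X in expR X]mulr1 expRM_natl lerXn2r ?nnegrE //.
rewrite -expRD ler_expR.
have : (1 - 3 * h) * D <= D / (1 + h) ^+ 3.
  have h3 : 0 < (1 + h) ^+ 3 by rewrite exprn_gt0 //; lra.
  rewrite ler_pdivlMr // mulrAC -[leRHS]mul1r ler_wpM2r //.
  have -> : (1 - 3 * h) * (1 + h) ^+ 3 =
    1 - (h ^+ 2 * (6 + 8 * h + 3 * h ^+ 2)) by ring.
  rewrite gerBl mulr_ge0 ?sqr_ge0 // !addr_ge0 ?mulr_ge0 ?sqr_ge0 //; exact: ltW.
lra.
Qed.

Theorem corollary1p5 (R : realType) (p delta : nat -> R)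
    (p01 : forall n, 0 < p n < 1)
    (p_to0 : p n @[n --> \oo] --> (0 : R))
    (p_lb : Num.sqrt n%:R * p n @[n --> \oo] --> +oo)
    (delta01 : forall n, 0 < delta n < 1)
    (delta_lb : delta n * n%:R * p n / Num.sqrt n%:R @[n --> \oo] --> +oo) :
  - ln (gnp_prob (p n)
          [pred G : {set {set 'I_n}} |
             delta n * n%:R * p n <= lambda 2 (adjmx R G)])
    / (2^-1 * delta n ^+ 2 * n%:R ^+ 2 * p n ^+ 2 * ln (1 / p n))
    @[n --> \oo] --> (1 : R).
Proof.
apply/cvgrPdist_le => eps eps0.
(* The two bounds lose [10 * e] and [4 * e]; the lower one also asks for [e <= 10^-1]. *)
pose e := Num.min (10^-1) (eps / 10).
have e0 : 0 < e by rewrite lt_min invr_gt0 ltr0n divr_gt0.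
have e1 : e <= 10^-1 by rewrite ge_min lexx.
have e2 : 10 * e <= eps.
  have : e <= eps / 10 by rewrite ge_min lexx orbT.
  lra.
pose M := (Num.truncn ((e / 2)^-1 * (1 + 2 / e))).+1.
have hM : 1 + 2 / e <= e / 2 * M%:R.
  by rewrite -ler_pdivrMl ?divr_gt0 // ltW // truncnS_gt.
(* Thresholds: [K] for [L] gives [64 <= L] and [16 <= e * L]. The terms of [A] ensure that [n] is
   small against [t ^+ 2], that [8 <= t], and that [2 <= e * t]. *)
pose K := Num.max 64 (16 / e).
pose A := (2 * M + 2)%:R / e + 8 + 2 / e.
have npos : \forall n \near \oo, (0 < n)%N by exists 1%N.
have plim x : 0 < x -> \forall n \near \oo, p n <= x.
  move=> x0; have /cvgr0Pnorm_le/(_ _ x0) := p_to0.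
  by apply: filterS => n; apply: le_trans; exact: ler_norm.
have h1 := plim (e ^+ 3 / (2 * 272 ^+ 2))
  (divr_gt0 (exprn_gt0 3 e0) (mulr_gt0 (ltr0n _ 2) (exprn_gt0 2 (ltr0n _ 272)))).
have h2 := plim (expR (- K)) (expR_gt0 _).
have /cvgryPge/(_ 4) h3 := p_lb.
have /cvgryPge/(_ A) h4 := delta_lb.
near=> n.
have n0 : (0 < n)%N by near: n.
have pe : p n <= e ^+ 3 / (2 * 272 ^+ 2) by near: n.
have pK : p n <= expR (- K) by near: n.
have sp : 4 <= Num.sqrt n%:R * p n by near: n; exact: h3.
have dA : A <= delta n * n%:R * p n / Num.sqrt n%:R by near: n; exact: h4.
have /andP[p0 p1] := p01 n; have /andP[d0 d1] := delta01 n.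
set t := delta n * n%:R * p n in dA *.
set L := ln (1 / p n).
set P := gnp_prob _ _.
have LK : K <= L.
  rewrite /L div1r lnV ?posrE // lerNr -[leRHS]expRK ler_ln ?posrE ?expR_gt0 //.
have L64 : 64 <= L by apply: le_trans LK; rewrite le_max lexx.
have eL : 16 <= e * L.
  have : 16 / e <= L by apply: le_trans LK; rewrite le_max lexx orbT.
  by rewrite ler_pdivrMr // mulrC.
set s := Num.sqrt n%:R in sp dA.
have s2 : s ^+ 2 = n%:R by rewrite sqr_sqrtr.
have s1 : 1 <= s by rewrite -sqrtr1 ler_wsqrtr // ler1n.
have st : A * s <= t by rewrite -ler_pdivlMr // (lt_le_trans ltr01).
have Me0 : 0 <= (2 * M + 2)%:R / e by rewrite divr_ge0 ?ler0n // ltW.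
have e2' : 0 <= 2 / e by rewrite divr_ge0 // ltW.
have A0 : 0 <= A by rewrite /A; clear -Me0 e2'; lra.
have At : A <= t by apply: le_trans st; rewrite ler_peMr.
have A8 : 8 <= A by rewrite /A; clear -Me0 e2'; lra.
have t8 : 8 <= t := le_trans A8 At.
have et : 2 <= e * t.
  rewrite mulrC -ler_pdivrMr // (le_trans _ At) // /A; clear -Me0; lra.
have t0 : 0 < t by clear -t8; lra.
have L0 : 0 < L by clear -L64; lra.
have tNp : t <= n%:R * p n.
  by rewrite /t -mulrA ler_piMl ?(ltW d1) // mulr_ge0 ?(ltW p0).
(* Here [128 = 4 * 4 * 8], from [sqrt n * p >= 4] twice and [n * p >= t >= 8]. *)
have pn3 : 128 <= p n ^+ 3 * n%:R ^+ 2.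
  have -> : p n ^+ 3 * n%:R ^+ 2 = (s * p n) * (s * p n) * (n%:R * p n).
    by rewrite -s2; ring.
  have : 4 * 4 <= (s * p n) * (s * p n) by rewrite ler_pM.
  move=> h; have : 4 * 4 * 8 <= (s * p n) * (s * p n) * (n%:R * p n).
    by rewrite ler_pM // (le_trans t8).
  by apply: le_trans; clear; lra.
(* Squaring [A * s <= t] bounds [n] by [t ^+ 2 / A ^+ 2], so the lattice count is negligible. *)
have hn : (2 * M + 2)%:R * n%:R <= e * (t ^+ 2 * L / 2).
  have As : A * A * n%:R <= t ^+ 2.
    have -> : A * A * n%:R = (A * s) ^+ 2 by rewrite -s2; ring.
    rewrite lerXn2r ?nnegrE ?(le_trans A0 At) // mulr_ge0 //.
    exact: le_trans ler01 s1.
  have A1 : (2 * M + 2)%:R / e <= A * A.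
    have : A * 1 <= A * A by rewrite ler_wpM2l //; clear -A8; lra.
    by apply: le_trans; rewrite mulr1 /A; clear -e2'; lra.
  have h : (2 * M + 2)%:R / e * n%:R <= t ^+ 2.
    by apply: le_trans As; rewrite ler_wpM2r ?ler0n.
  have {}h : (2 * M + 2)%:R * n%:R <= e * t ^+ 2.
    have -> : (2 * M + 2)%:R * n%:R = e * ((2 * M + 2)%:R / e * n%:R).
      by field; rewrite gt_eqF.
    by rewrite ler_wpM2l // ltW.
  apply: (le_trans h); have -> : e * (t ^+ 2 * L / 2) = e * t ^+ 2 * (L / 2) by ring.
  rewrite ler_peMr //; first by rewrite mulr_ge0 ?sqr_ge0 // ltW.
  by clear -L64; lra.
have lo : expR (- ((1 + 10 * e) * (t ^+ 2 * L / 2))) <= P.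
  apply: gnp_lambda2_lower_exp => //; rewrite -/L ?e0 ?d0 //.
  by clear -L64; lra.
have up : P <= expR (- ((1 - 4 * e) * (t ^+ 2 * L / 2))).
  apply: (@gnp_lambda2_upper_exp R n M) => //; rewrite e0; clear -e1; lra.
have -> : 2^-1 * delta n ^+ 2 * n%:R ^+ 2 * p n ^+ 2 * L = t ^+ 2 * L / 2.
  by rewrite /t; ring.
have D0 : 0 < t ^+ 2 * L / 2.
  by rewrite divr_gt0 // mulr_gt0 ?exprn_gt0.
set D := t ^+ 2 * L / 2 in lo up D0 *.
have P0 : 0 < P by apply: lt_le_trans lo; exact: expR_gt0.
have lnlo : - ((1 + 10 * e) * D) <= ln P by rewrite -[leLHS]expRK ler_ln ?posrE ?expR_gt0.
have lnup : ln P <= - ((1 - 4 * e) * D) by rewrite -[leRHS]expRK ler_ln ?posrE ?expR_gt0.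
have -> : 1 - - ln P / D = (D + ln P) / D by field; rewrite gt_eqF.
rewrite normrM normfV (gtr0_norm D0) ler_pdivrMr // ler_norml.
have : 10 * e * D <= eps * D by rewrite ler_wpM2r // ltW.
have : 0 <= e * D by rewrite mulr_ge0 // ltW.
by move=> h5 h6; apply/andP; split; clear -lnlo lnup h5 h6; lra.
Unshelve. all: by end_near.
Qed.
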